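(* Let $0\le b_1<b_2<\infty$. Let $\kappa$ be an optimal quasi-eigenvalue for a frequency $\alpha\in\mathbb{R}$. Then there exists a nonzero solution $y\in W^{2,\infty}_{\mathbb{C}}[0,1]$ of the nonlinear boundary value problem $$y''(x)+\kappa^2y(x)\left[b_1+(b_2-b_1)\chi_{\mathbb{C}_+}\!\left(y^2(x)\right)\right]=0\ \text{ a.e. on }(0,1),\qquad y'(0)=0,\qquad y(1)-\mathrm{i}\,y'(1)/\kappa=0 .$$ Moreover, $B(x)=b_1+(b_2-b_1)\chi_{\mathbb{C}_+}\!\left(y^2(x)\right)$ is an optimal structure for the frequency $\alpha$.
   Context: $\chi_{\mathbb{C}_+}(z):=1$ if $\operatorname{Im}z>0$ and $\chi_{\mathbb{C}_+}(z):=0$ if $\operatorname{Im}z\le0$. $\mathrm{Ad}:=\{B\in L^\infty_{\mathbb{R}}(0,1): b_1\le B(x)\le b_2 \text{ for a.a. } x\in(0,1)\}$. For $B\in L^\infty(0,1)$, a number $\kappa\in\mathbb{C}$, $\kappa\ne0$, is called a quasi-eigenvalue of $B$ if there is a nonzero solution $y\in W^{2,\infty}_{\mathbb{C}}[0,1]$ of $y''(x)+\kappa^2B(x)y(x)=0$ for a.a. $x\in(0,1)$ with $y'(0)=0$ and $y(1)-\mathrm{i}\,y'(1)/\kappa=0$. $K(B)$ denotes the set of all quasi-eigenvalues of $B$, and $K(\mathrm{Ad}):=\bigcup_{B\in\mathrm{Ad}}K(B)$. For $\alpha\in\mathbb{R}$ put $\mathcal{I}(\alpha):=+\infty$ if there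 is no $\kappa\in K(\mathrm{Ad})$ with $\operatorname{Re}\kappa=\alpha$; otherwise $\mathcal{I}(\alpha):=\min\{\operatorname{Im}\kappa:\operatorname{Re}\kappa=\alpha,\ \kappa\in K(\mathrm{Ad})\}$ (this minimum is attained and positive). If $\mathcal{I}(\alpha)<\infty$, then $\kappa=\alpha+\mathrm{i}\,\mathcal{I}(\alpha)$ is called the optimal quasi-eigenvalue for the frequency $\alpha$, and a structure $B\in\mathrm{Ad}$ is called optimal for the frequency $\alpha$ if $\alpha+\mathrm{i}\,\mathcal{I}(\alpha)\in K(B)$. *)

(* Defs.v *)
From HB Require Import structures.
From mathcomp Require Import all_boot all_order all_algebra.
From mathcomp Require Import all_classical all_reals all_analysis.
From mathcomp Require Import complex.

Set Implicit Arguments.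
Unset Strict Implicit.
Unset Printing Implicit Defensive.

Import Order.TTheory GRing.Theory Num.Theory.
Import numFieldNormedType.Exports.

Local Open Scope classical_set_scope.
Local Open Scope ring_scope.
Local Open Scope complex_scope.

Local Notation leb R := (@lebesgue_measure R).

Section Defs.
Variable R : realType.
Implicit Types (f g B : R -> R) (y : R -> R[i]) (kappa : R[i]) (alpha : R).

(* Functions on (0,1) or [0,1] are represented by functions on R whose values
   outside the interval are irrelevant; hence the extension by zero below. *)
Definition Linf01 f : Prop := f \_ `]0, 1[ \in Lfun (leb R) +oo%E.

(* f is absolutely continuous on [0,1] and g is its (a.e.) derivative, i.e.
   f is an indefinite Lebesgue integral of g. *)
Definition AC01_deriv f g : Prop :=
  (leb R).-integrable `[0, 1] (EFin \o g) /\
  forall x : R, 0 <= x <= 1 -> f x = f 0 + (\int[leb R]_(t in `[0%R, x]) g t)%R.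

Definition cRe y : R -> R := fun x => complex.Re (y x).
Definition cIm y : R -> R := fun x => complex.Im (y x).

Definition cLinf01 y : Prop := Linf01 (cRe y) /\ Linf01 (cIm y).

Definition cAC01_deriv y y1 : Prop :=
  AC01_deriv (cRe y) (cRe y1) /\ AC01_deriv (cIm y) (cIm y1).

(* y is in W^{2,oo}[0,1] with complex values, y1 = y' and y2 = y''. In dimension
   one this means that y and y' are absolutely continuous on [0,1] (so that
   y'(0), y(1), y'(1) make sense) and y'' is in L^oo. The function y1 is
   determined by y on [0,1], and y2 is determined almost everywhere. *)
Definition W2_inf y y1 y2 : Prop :=
  [/\ cAC01_deriv y y1, cAC01_deriv y1 y2 & cLinf01 y2].

Definition bvp_solution kappa B y : Prop :=
  exists y1 y2 : R -> R[i],
  [/\ W2_inf y y1 y2,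
      exists2 x : R, 0 <= x <= 1 & y x != 0,
      {ae leb R, forall x : R, 0 < x < 1 ->
         y2 x + kappa ^+ 2 * (B x)%:C * y x = 0},
      y1 0 = 0 &
      y 1 - (0 +i* 1) * y1 1 / kappa = 0].

Definition quasi_eigs B : set R[i] :=
  [set kappa | kappa != 0 /\ exists y, bvp_solution kappa B y].

Definition Ad (b1 b2 : R) : set (R -> R) :=
  [set B | Linf01 B /\
           {ae leb R, forall x : R, 0 < x < 1 -> b1 <= B x <= b2}].

Definition quasi_eigs_Ad (b1 b2 : R) : set R[i] :=
  \bigcup_(B in Ad b1 b2) quasi_eigs B.

Definition is_min (A : set R) (m : R) : Prop := A m /\ lbound A m.

Definition Im_on_line (b1 b2 alpha : R) : set R :=
  [set complex.Im kappa | kappa in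
     [set kappa | complex.Re kappa = alpha /\ quasi_eigs_Ad b1 b2 kappa]].

(* The minimum of Im_on_line, or +oo if there is none, i.e. if the set is empty
   (by compactness the minimum is attained whenever the set is nonempty). *)
Definition calI (b1 b2 alpha : R) : \bar R :=
  xget +oo%E (EFin @` is_min (Im_on_line b1 b2 alpha)).

Definition optimal_qe (b1 b2 alpha : R) kappa : Prop :=
  exists beta, calI b1 b2 alpha = beta%:E /\ kappa = alpha +i* beta.

Definition optimal_structure (b1 b2 alpha : R) B : Prop :=
  Ad b1 b2 B /\
  exists beta, calI b1 b2 alpha = beta%:E /\ quasi_eigs B (alpha +i* beta).

Definition chiCplus (z : R[i]) : R := if 0 < complex.Im z then 1 else 0.

Definition bang_bang (b1 b2 : R) y : R -> R :=
  fun x => b1 + (b2 - b1) * chiCplus (y x ^+ 2).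

End Defs.

(* Main.v *)
Require Import Defs.
From mathcomp Require Import all_boot all_order all_algebra.
From mathcomp Require Import all_classical all_reals all_analysis.
From mathcomp Require Import measurable_realfun ess_sup_inf.
From mathcomp Require Import complex ring lra.

Set Implicit Arguments.
Unset Strict Implicit.
Unset Printing Implicit Defensive.

Import Order.TTheory GRing.Theory Num.Theory.
Import numFieldNormedType.Exports.

Local Open Scope classical_set_scope.
Local Open Scope ring_scope.
Local Open Scope complex_scope.

Local Notation leb R := (@lebesgue_measure R).
Local Notation Re := complex.Re.
Local Notation Im := complex.Im.

(** Write [k = kappa ^ 2] and let [u0] be a mode of an admissible structure [B0]
whose quasi-eigenvalue [kappa] is optimal for the frequency [alpha]. The Green
identity of [u0] with a solution [u] of [u'' + z ^ 2 (B0 + V) u = 0] turns the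
radiation condition for [u] at [z] into one complex equation, whose leading
part as a functional of [V] is the first variation [int V u0 ^ 2]. The values
of the first variation over [V = B - B0], [B] admissible, generate a convex cone
in the plane, and there are two cases ([complex_cone_halfplane]).

If this cone is the whole plane, the equation can be solved for [V] at every
[z] close to [kappa] ([persistence], [full_cone_perturbation]). One picks a
family [V = W w], [w] complex, with [int W w u0 ^ 2 = w], and solves
simultaneously for the mode and for [w] by a contraction. Since [z] is prescribed
and the structure is the unknown, this works for a quasi-eigenvalue [kappa] of
any multiplicity. Then [kappa - i delta] is a quasi-eigenvalue on the same vertical line,
against the minimality of [Im kappa].

Hence the cone lies in a half-plane [Re (c z) <= 0] ([halfplane_bang_bang]).
Choosing [d ^ 2 = i c] and [y = d u0], this says that [B0] maximises
[int B Im (y ^ 2)], so [B0] agrees almost everywhere with the bang-bang structure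
of [y] off the set where [y ^ 2] is real. On that set the real or
the imaginary part of [y] vanishes; almost everywhere there, so does the same
part of [y''], and since [k] is not real this forces [B0 y = 0]. So either [y = 0], or [B0 = 0], and
then [b1 = 0] is also the value of the bang-bang structure. In both cases [y]
solves the nonlinear equation.

The argument needs [k] non-real and [u0 1] nonzero. The latter is backward
uniqueness for the linear equation. If [alpha] is nonzero, then [Im kappa] is
nonzero by the Wronskian of [u0] and its conjugate, so [k] is not real. If
[alpha = 0], then [kappa = i beta] and everything is real: comparing the mode
with that of the constant structure [b2], a hyperbolic cosine, yields a
quasi-eigenvalue [i b] of this constant with [0 < b <= beta]; minimality gives
[b = beta], and the hyperbolic cosine multiplied by a square root of [i] solves
the nonlinear problem ([zero_frequency]).

Complex numbers are measured by the norm |Re z| + |Im z|, which is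
submultiplicative and makes all estimates of complex integrals reduce to real
ones. *)

(** * Integrals of bounded measurable functions on [0, 1] *)

Lemma le_of_eq (R : realType) (a b : R) : a = b -> a <= b. Proof. by move=> ->. Qed.

Section RealIntegrals.
Variable R : realType.
Implicit Types (f g : R -> R) (a b c x M : R).

(** Only the values on [[0, 1]] matter: modes are arbitrary elsewhere. *)
Definition bmeas f : Prop :=
  measurable_fun (`[0, 1] : set R) f /\
  exists M, forall x, 0 <= x <= 1 -> `|f x| <= M.

Definition rint f a b : R := (\int[leb R]_(t in `[a, b]) f t)%R.

Lemma subitv01 a b : 0 <= a -> b <= 1 -> `[a, b] `<=` (`[0, 1] : set R).
Proof.
move=> a0 b1 x; rewrite /= !in_itv /= => /andP[ax xb].
by rewrite (le_trans a0 ax) (le_trans xb b1).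
Qed.

Lemma bmeas_integrable f a b : bmeas f -> 0 <= a -> b <= 1 ->
  (leb R).-integrable `[a, b] (EFin \o f).
Proof.
move=> [mf [M fM]] a0 b1.
have i01 : (leb R).-integrable `[0, 1] (EFin \o f).
  apply: measurable_bounded_integrable => //.
  - rewrite [ltLHS](_ : _ = (1%:E)%E) ?ltry //.
    by rewrite [LHS]lebesgue_measure_itv /= lte_fin ltr01 oppr0 adde0.
  - exists M; split; first exact: num_real.
    move=> y My x; rewrite /= in_itv /= => x01.
    exact: le_trans (fM x x01) (ltW My).
by apply: integrableS i01 => //; exact: subitv01.
Qed.

Lemma bmeas_eq f g : (forall x, 0 <= x <= 1 -> f x = g x) -> bmeas f -> bmeas g.
Proof.
move=> fg [mf [M fM]]; split.
  apply: (eq_measurable_fun f) => // x; rewrite inE /= in_itv /=.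
  exact: fg.
by exists M => x x01; rewrite -fg //; exact: fM.
Qed.

Lemma bmeas_cst c : bmeas (fun=> c).
Proof. by split; [exact: measurable_cst|exists `|c|]. Qed.

Lemma bmeasD f g : bmeas f -> bmeas g -> bmeas (fun x => f x + g x).
Proof.
move=> [mf [M fM]] [mg [L gL]]; split; first exact: measurable_funD.
exists (M + L) => x x01; apply: le_trans (ler_normD _ _) _.
by rewrite lerD ?fM ?gL.
Qed.

Lemma bmeasM f g : bmeas f -> bmeas g -> bmeas (fun x => f x * g x).
Proof.
move=> [mf [M fM]] [mg [L gL]]; split; first exact: measurable_funM.
exists (M * L) => x x01; rewrite normrM.
by rewrite ler_pM ?fM ?gL.
Qed.

Lemma bmeasZ c f : bmeas f -> bmeas (fun x => c * f x).
Proof. by move=> bf; apply: bmeasM => //; exact: bmeas_cst. Qed.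

Lemma bmeasN f : bmeas f -> bmeas (fun x => - f x).
Proof.
move=> bf; apply: (@bmeas_eq (fun x => -1 * f x)); last exact: bmeasZ.
by move=> x _; rewrite mulN1r.
Qed.

Lemma bmeasB f g : bmeas f -> bmeas g -> bmeas (fun x => f x - g x).
Proof. by move=> bf bg; apply: bmeasD => //; exact: bmeasN. Qed.

Lemma bmeas_norm f : bmeas f -> bmeas (fun x => `|f x|).
Proof.
move=> [mf [M fM]]; split; first exact: measurableT_comp.
by exists M => x x01; rewrite normr_id fM.
Qed.

Lemma bmeas_cont f : {within `[0, 1], continuous f} -> bmeas f.
Proof.
move=> cf; split; first exact: subspace_continuous_measurable_fun.
have [M [Mr fM]] : bounded_set (f @` `[0, 1]).
  by apply: compact_bounded; apply: continuous_compact => //; exact: segment_compact.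
exists (M + 1) => x x01; apply: (fM (M + 1)); first by rewrite ltrDl.
by exists x => //; rewrite /= in_itv.
Qed.

Lemma rint_split f a b : bmeas f -> 0 <= a -> a <= b -> b <= 1 ->
  rint f 0 b = rint f 0 a + rint f a b.
Proof.
move=> bf a0 ab b1; apply/eqP; rewrite addrC -subr_eq; apply/eqP.
have i0b := bmeas_integrable bf (lexx 0) b1.
have iab := bmeas_integrable bf a0 b1.
rewrite /rint Rintegral_itvB ?bnd_simp //.
rewrite Rintegral_itv_obnd_cbnd //.
by apply: integrableS iab => //; exact: subset_itv_oc_cc.
Qed.

Lemma rint_eq f g a b : (forall x, a <= x <= b -> f x = g x) ->
  rint f a b = rint g a b.
Proof.
move=> fg; apply: eq_Rintegral => x; rewrite inE /= in_itv /=; exact: fg.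
Qed.

Lemma rintD f g a b : bmeas f -> bmeas g -> 0 <= a -> b <= 1 ->
  rint (fun x => f x + g x) a b = rint f a b + rint g a b.
Proof. by move=> *; rewrite /rint RintegralD //; exact: bmeas_integrable. Qed.

Lemma rintB f g a b : bmeas f -> bmeas g -> 0 <= a -> b <= 1 ->
  rint (fun x => f x - g x) a b = rint f a b - rint g a b.
Proof. by move=> *; rewrite /rint RintegralB //; exact: bmeas_integrable. Qed.

Lemma rintZ f c a b : bmeas f -> 0 <= a -> b <= 1 ->
  rint (fun x => c * f x) a b = c * rint f a b.
Proof. by move=> *; rewrite /rint RintegralZl //; exact: bmeas_integrable. Qed.

Lemma le_rint f g a b : bmeas f -> bmeas g -> 0 <= a -> b <= 1 ->
  (forall x, a <= x <= b -> f x <= g x) -> rint f a b <= rint g a b.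
Proof.
move=> bf bg a0 b1 fg; apply: le_Rintegral => //; try exact: bmeas_integrable.
Qed.

Lemma rint_ge0 f a b : (forall x, a <= x <= b -> 0 <= f x) -> 0 <= rint f a b.
Proof. by move=> f0; apply: Rintegral_ge0 => x; rewrite /= in_itv /=; exact: f0. Qed.

Lemma rint_norm f a b : bmeas f -> 0 <= a -> b <= 1 ->
  `|rint f a b| <= rint (fun x => `|f x|) a b.
Proof. by move=> *; apply: le_normr_Rintegral => //; exact: bmeas_integrable. Qed.

Lemma rint0 (a b : R) : rint (fun=> 0) a b = 0.
Proof. by rewrite /rint /Rintegral integral0. Qed.

Lemma rint_cst c a b : a <= b -> rint (fun=> c) a b = c * (b - a).
Proof.
move=> ab; rewrite /rint Rintegral_cst //=; congr (_ * _).
rewrite lebesgue_measure_itv /= lte_fin.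
case: ltP => // ba; rewrite (_ : b = a) ?subrr //.
by apply/eqP; rewrite eq_le ba ab.
Qed.

Lemma rint_point f a : rint f a a = 0.
Proof. by rewrite /rint set_itv1 Rintegral_set1. Qed.

(** Stated for integrable [f] because the derivative of a mode is at first only
known to be integrable. *)
Lemma bmeas_rint f : (leb R).-integrable `[0, 1] (EFin \o f) ->
  bmeas (fun x => rint f 0 x).
Proof.
move=> fi; apply: bmeas_cont.
exact: (parameterized_integral_continuous ler01 fi).
Qed.

Lemma continuous_expM (a : R) : continuous (fun t : R => expR (a * t)).
Proof.
move=> t; apply: (@continuous_comp _ _ _ (fun t : R => a * t) expR); last exact: continuous_expR.
exact: mulrl_continuous.
Qed.

Lemma rint_exp c a b : c != 0 -> a <= b ->
  rint (fun t => expR (c * t)) a b = (expR (c * b) - expR (c * a)) / c.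
Proof.
move=> c0; rewrite le_eqVlt => /predU1P[->|ab].
  by rewrite rint_point subrr mul0r.
pose F (t : R) := c^-1 * expR (c * t).
have dF (x : R) : is_derive x 1 F (expR (c * x)).
  have h1 : is_derive x 1 (fun t : R => c * t) c.
    by apply: is_derive_eq; rewrite /GRing.scale /= mulr1.
  have h2 : is_derive x 1 (expR \o (fun t : R => c * t)) (c * expR (c * x)).
    by apply: is_derive_eq; rewrite mulrC.
  have h3 : is_derive x 1 (c^-1 \*: (expR \o (fun t : R => c * t))) (c^-1 *: (c * expR (c * x))).
    exact: is_deriveZ.
  by apply: is_derive_eq; rewrite /GRing.scale /= mulKf.
have cF (x : R) : {for x, continuous F}.
  by apply: differentiable_continuous; apply/derivable1_diffP; exact: ex_derive.
rewrite /rint /Rintegral (@continuous_FTC2 _ _ F) //=.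
- by rewrite /F -mulrBr mulrC.
- by apply: continuous_subspaceT; exact: continuous_expM.
- split.
  + by move=> x _; exact: ex_derive.
  + exact/cvg_at_right_filter/cF.
  + exact/cvg_at_left_filter/cF.
- by move=> x _; rewrite derive1E derive_val.
Qed.

Lemma bmeas_exp (a : R) : bmeas (fun t => expR (a * t)).
Proof. apply: bmeas_cont; apply: continuous_subspaceT; exact: continuous_expM. Qed.
End RealIntegrals.

(** * Complex-valued functions and the l1 norm of complex numbers *)

Section ComplexIntegrals.
Variable R : realType.
Implicit Types (f g : R -> R[i]) (z w c : R[i]) (a b x M : R).

Lemma ReCD z w : Re (z + w) = Re z + Re w. Proof. by case: z; case: w. Qed.
Lemma ImCD z w : Im (z + w) = Im z + Im w. Proof. by case: z; case: w. Qed.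
Lemma ReCN z : Re (- z) = - Re z. Proof. by case: z. Qed.
Lemma ImCN z : Im (- z) = - Im z. Proof. by case: z. Qed.
Lemma ReCM z w : Re (z * w) = Re z * Re w - Im z * Im w.
Proof. by case: z; case: w. Qed.
Lemma ImCM z w : Im (z * w) = Re z * Im w + Im z * Re w.
Proof. by case: z; case: w. Qed.
Lemma ReCJ z : Re (conjc z) = Re z. Proof. by case: z. Qed.
Lemma ImCJ z : Im (conjc z) = - Im z. Proof. by case: z. Qed.
Lemma ReCR (a : R) : Re a%:C = a. Proof. by []. Qed.
Lemma ImCR (a : R) : Im a%:C = 0. Proof. by []. Qed.
Definition ReImE := (ReCD, ImCD, ReCN, ImCN, ReCM, ImCM, ReCJ, ImCJ, ReCR, ImCR).

Lemma complex_ext z w : Re z = Re w -> Im z = Im w -> z = w.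
Proof. by case: z; case: w => ? ? ? ? /= -> ->. Qed.

Definition l1norm z : R := `|Re z| + `|Im z|.
Local Notation N := l1norm.

Lemma l1norm_ge0 z : 0 <= N z. Proof. by rewrite addr_ge0. Qed.

Lemma l1norm_eq0 z : N z <= 0 -> z = 0.
Proof.
move=> z0; apply: complex_ext; apply/eqP; rewrite -normr_eq0 -[_ == _]andTb /=.
  by rewrite eq_le normr_ge0 (le_trans _ z0) // lerDl.
by rewrite eq_le normr_ge0 (le_trans _ z0) // lerDr.
Qed.

Lemma l1norm0 : N 0 = 0. Proof. by rewrite /N /= normr0 addr0. Qed.

Lemma l1normN z : N (- z) = N z.
Proof. by rewrite /N !ReImE !normrN. Qed.

Lemma l1normD z w : N (z + w) <= N z + N w.
Proof.
by rewrite /N !ReImE addrACA lerD // ler_normD.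
Qed.

Lemma l1normBC z w : N (z - w) = N (w - z).
Proof. by rewrite -l1normN opprB. Qed.

Lemma l1normM z w : N (z * w) <= N z * N w.
Proof.
rewrite /N !ReImE.
have h1 := ler_normB (Re z * Re w) (Im z * Im w).
have h2 := ler_normD (Re z * Im w) (Im z * Re w).
apply: le_trans (lerD h1 h2) _; rewrite !normrM; lra.
Qed.

Lemma l1norm_mul_le z w (a b : R) : N z <= a -> N w <= b -> N (z * w) <= a * b.
Proof.
move=> za wb; apply: le_trans (l1normM _ _) _.
by apply: ler_pM => //; exact: l1norm_ge0.
Qed.

Lemma l1norm_add_le z w (a b : R) : N z <= a -> N w <= b -> N (z + w) <= a + b.
Proof. by move=> za wb; apply: le_trans (l1normD _ _) _; exact: lerD. Qed.

Lemma l1norm_sub_le z w (a b : R) : N z <= a -> N w <= b -> N (z - w) <= a + b.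
Proof. by move=> za wb; apply: l1norm_add_le => //; rewrite l1normN. Qed.

Lemma l1normR (a : R) : N a%:C = `|a|.
Proof. by rewrite /N /= normr0 addr0. Qed.

Lemma l1normi : N (0 +i* 1) = 1.
Proof. by rewrite /N /= normr0 normr1 add0r. Qed.

Lemma Re_le_l1norm z : `|Re z| <= N z. Proof. by rewrite lerDl. Qed.
Lemma Im_le_l1norm z : `|Im z| <= N z. Proof. by rewrite lerDr. Qed.

Definition cbmeas f : Prop := bmeas (cRe f) /\ bmeas (cIm f).

Definition cint f a b : R[i] := rint (cRe f) a b +i* rint (cIm f) a b.

Lemma cbmeas_eq f g : (forall x, 0 <= x <= 1 -> f x = g x) -> cbmeas f -> cbmeas g.
Proof.
move=> fg [rf jf]; split.
  by apply: bmeas_eq rf => x x01; rewrite /cRe fg.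
by apply: bmeas_eq jf => x x01; rewrite /cIm fg.
Qed.

Lemma cbmeas_cst c : cbmeas (fun=> c). Proof. by split; exact: bmeas_cst. Qed.

Lemma cbmeasD f g : cbmeas f -> cbmeas g -> cbmeas (fun x => f x + g x).
Proof.
move=> [rf jf] [rg jg]; split.
  by apply: bmeas_eq (bmeasD rf rg) => x _; rewrite /cRe ReCD.
by apply: bmeas_eq (bmeasD jf jg) => x _; rewrite /cIm ImCD.
Qed.

Lemma cbmeasM f g : cbmeas f -> cbmeas g -> cbmeas (fun x => f x * g x).
Proof.
move=> [rf jf] [rg jg]; split.
  apply: bmeas_eq (bmeasB (bmeasM rf rg) (bmeasM jf jg)) => x _.
  by rewrite /cRe ReCM.
apply: bmeas_eq (bmeasD (bmeasM rf jg) (bmeasM jf rg)) => x _.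
by rewrite /cIm ImCM.
Qed.

Lemma cbmeasZ c f : cbmeas f -> cbmeas (fun x => c * f x).
Proof. by move=> bf; apply: cbmeasM => //; exact: cbmeas_cst. Qed.

Lemma cbmeasN f : cbmeas f -> cbmeas (fun x => - f x).
Proof.
by move=> bf; apply: cbmeas_eq (cbmeasZ (-1) bf) => x _; rewrite mulN1r.
Qed.

Lemma cbmeasB f g : cbmeas f -> cbmeas g -> cbmeas (fun x => f x - g x).
Proof. by move=> bf bg; apply: cbmeasD => //; exact: cbmeasN. Qed.

Lemma cbmeas_conj f : cbmeas f -> cbmeas (fun x => conjc (f x)).
Proof.
move=> [rf jf]; split.
  by apply: bmeas_eq rf => x _; rewrite /cRe ReCJ.
by apply: bmeas_eq (bmeasN jf) => x _; rewrite /cIm ImCJ.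
Qed.

Lemma cbmeasR (h : R -> R) : bmeas h -> cbmeas (fun x => (h x)%:C).
Proof. by move=> bh; split; [apply: bmeas_eq bh|exact: bmeas_cst]. Qed.

Lemma bmeas_l1norm f : cbmeas f -> bmeas (fun x => N (f x)).
Proof. by move=> [rf jf]; apply: bmeasD; exact: bmeas_norm. Qed.

Lemma cbmeas_bound f : cbmeas f -> exists2 M, 1 <= M & forall x, 0 <= x <= 1 -> N (f x) <= M.
Proof.
move=> /bmeas_l1norm[_ [M fM]]; exists (Num.max 1 M); first by rewrite le_max lexx.
by move=> x x01; rewrite le_max (le_trans (ler_norm _) (fM x x01)) orbT.
Qed.

Lemma cint_eq f g a b : (forall x, a <= x <= b -> f x = g x) ->
  cint f a b = cint g a b.
Proof.
move=> fg; rewrite /cint; congr (_ +i* _); apply: rint_eq => x xab.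
  by rewrite /cRe fg.
by rewrite /cIm fg.
Qed.

Lemma cint_split f a b : cbmeas f -> 0 <= a -> a <= b -> b <= 1 ->
  cint f 0 b = cint f 0 a + cint f a b.
Proof.
move=> [rf jf] *; apply: complex_ext => /=; exact: rint_split.
Qed.

Lemma cintD f g a b : cbmeas f -> cbmeas g -> 0 <= a -> b <= 1 ->
  cint (fun x => f x + g x) a b = cint f a b + cint g a b.
Proof.
move=> [rf jf] [rg jg] a0 b1; apply: complex_ext => /=; rewrite -rintD //;
  by apply: rint_eq => x _; rewrite /cRe /cIm ReImE.
Qed.

Lemma cintZ f c a b : cbmeas f -> 0 <= a -> b <= 1 ->
  cint (fun x => c * f x) a b = c * cint f a b.
Proof.
move=> [rf jf] a0 b1; apply: complex_ext.
  rewrite [RHS]ReCM /= -!rintZ // -rintB //; try exact: bmeasZ.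
  by apply: rint_eq => x _; rewrite /cRe ReCM.
rewrite [RHS]ImCM /= -!rintZ // -rintD //; try exact: bmeasZ.
by apply: rint_eq => x _; rewrite /cIm ImCM.
Qed.

Lemma cintN f a b : cbmeas f -> 0 <= a -> b <= 1 ->
  cint (fun x => - f x) a b = - cint f a b.
Proof.
move=> bf a0 b1; rewrite -mulN1r -cintZ //.
by apply: cint_eq => x _; rewrite mulN1r.
Qed.

Lemma cintB f g a b : cbmeas f -> cbmeas g -> 0 <= a -> b <= 1 ->
  cint (fun x => f x - g x) a b = cint f a b - cint g a b.
Proof. by move=> bf bg a0 b1; rewrite cintD ?cintN //; exact: cbmeasN. Qed.

Lemma cint_norm f (g : R -> R) a b : cbmeas f -> bmeas g -> 0 <= a -> b <= 1 ->
  (forall x, a <= x <= b -> N (f x) <= g x) -> N (cint f a b) <= rint g a b.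
Proof.
move=> bf bg a0 b1 fg; have [rf jf] := bf; rewrite /N /=.
apply: le_trans (lerD (rint_norm rf a0 b1) (rint_norm jf a0 b1)) _.
rewrite -rintD //; try exact: bmeas_norm.
by apply: le_rint => //; exact: bmeas_l1norm.
Qed.

Lemma cint_bound f M a b : cbmeas f -> 0 <= a -> a <= b -> b <= 1 ->
  (forall x, a <= x <= b -> N (f x) <= M) -> N (cint f a b) <= M * (b - a).
Proof.
by move=> bf a0 ab b1 fM; rewrite -rint_cst //; apply: cint_norm => //; exact: bmeas_cst.
Qed.

Lemma cint01_bound f M : cbmeas f ->
  (forall x, 0 <= x <= 1 -> N (f x) <= M) -> N (cint f 0 1) <= M.
Proof.
by move=> bf fM; have := cint_bound bf (lexx 0) ler01 (lexx 1) fM; rewrite subr0 mulr1.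
Qed.

Lemma cint_point f a : cint f a a = 0.
Proof. by rewrite /cint !rint_point. Qed.

Lemma cbmeas_cint f : cbmeas f -> cbmeas (fun x => cint f 0 x).
Proof.
by move=> [rf jf]; split; apply: bmeas_rint; exact: bmeas_integrable.
Qed.

(** Absolute continuity of [f] with derivative [g] on [[0, 1]]. *)
Definition primitive f g : Prop :=
  forall x, 0 <= x <= 1 -> f x = f 0 + cint g 0 x.

Lemma primitive_cbmeas f g : cbmeas g -> primitive f g -> cbmeas f.
Proof.
move=> bg fg; apply: cbmeas_eq (cbmeasD (cbmeas_cst (f 0)) (cbmeas_cint bg)) => x x01.
by rewrite -fg.
Qed.

Lemma primitive_diff f g a b : cbmeas g -> primitive f g -> 0 <= a -> a <= b -> b <= 1 ->
  f b - f a = cint g a b.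
Proof.
move=> bg fg a0 ab b1.
rewrite (fg b) ?(le_trans a0 ab) // (fg a) ?a0 ?(le_trans ab b1) //.
rewrite (cint_split bg a0 ab b1); ring.
Qed.

(** Cutting [[a, b]] into [n] equal pieces bounds the increment by
[n * C * ((b - a) / n) ^ 2], which tends to 0. *)
Lemma subquadratic_const (D : R -> R[i]) C :
  (forall a b, 0 <= a -> a <= b -> b <= 1 -> N (D b - D a) <= C * (b - a) ^+ 2) ->
  forall a b, 0 <= a -> a <= b -> b <= 1 -> D b = D a.
Proof.
move=> DC a b a0 ab b1.
have C0 : 0 <= C.
  have := DC 0 1 (lexx 0) ler01 (lexx 1); rewrite subr0 expr1n mulr1.
  exact: le_trans (l1norm_ge0 _).
have step (n : nat) : N (D b - D a) * (n.+1)%:R <= C.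
  pose t (k : nat) : R := a + (b - a) * (k%:R / n.+1%:R).
  have t01 (k : nat) : (k <= n.+1)%N -> 0 <= t k <= 1.
    move=> kn; have k1 : k%:R / n.+1%:R <= 1 :> R.
      by rewrite ler_pdivrMr ?ltr0n // mul1r ler_nat.
    have k0 : 0 <= k%:R / n.+1%:R :> R by rewrite divr_ge0.
    rewrite /t; move: k0 k1; set s := _ / _ => k0 k1.
    have h0 : 0 <= (b - a) * s by rewrite mulr_ge0 ?subr_ge0.
    have h1 : (b - a) * s <= b - a by rewrite ler_piMr ?subr_ge0.
    by apply/andP; split; lra.
  have tS (k : nat) : t k.+1 - t k = (b - a) / n.+1%:R.
    rewrite /t -[k.+1]addn1 natrD.
    have : n.+1%:R != 0 :> R by rewrite pnatr_eq0.
    by move: (n.+1%:R) => m m0; field.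
  have tSle (k : nat) : t k <= t k.+1.
    by rewrite -subr_ge0 tS divr_ge0 // subr_ge0.
  have bnd (k : nat) : (k <= n.+1)%N ->
      N (D (t k) - D a) <= k%:R * (C * ((b - a) / n.+1%:R) ^+ 2).
    elim: k => [_|k IH kn].
      by rewrite /t mul0r mulr0 addr0 subrr l1norm0 mul0r.
    have -> : D (t k.+1) - D a = (D (t k.+1) - D (t k)) + (D (t k) - D a) by ring.
    apply: le_trans (l1normD _ _) _.
    rewrite -[k.+1]add1n natrD mulrDl mul1r lerD ?IH 1?ltnW // -(tS k).
    have /andP[h1 _] := t01 k (ltnW kn); have /andP[_ h2] := t01 _ kn.
    exact: DC.
  have := bnd n.+1 (leqnn _).
  have -> : t n.+1 = b by rewrite /t divff ?pnatr_eq0 // mulr1; ring.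
  have n0 : 0 < n.+1%:R :> R by rewrite ltr0n.
  rewrite -(ler_pM2r n0) => /le_trans; apply.
  have -> : n.+1%:R * (C * ((b - a) / n.+1%:R) ^+ 2) * n.+1%:R = C * (b - a) ^+ 2.
    by move: (n.+1%:R) n0 => m m0; field; rewrite gt_eqF.
  rewrite -[leRHS]mulr1 ler_wpM2l // expr_le1 //; lra.
apply/eqP; rewrite -subr_eq0; apply/eqP/l1norm_eq0; rewrite leNgt; apply/negP => D0.
have := step (Num.truncn (C / N (D b - D a))); rewrite leNgt => /negP; apply.
by rewrite mulrC -ltr_pdivrMr // truncnS_gt.
Qed.

(** The product rule. No derivative is available pointwise, since [f'] and [g']
are only bounded and measurable; but [f * g] minus the candidate primitive has
increments bounded by the square of the step, because
[f' t * (g b - g t) + (f a - f t) * g' t] is of the order of the step. *)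
Lemma primitiveM f g f' g' : cbmeas f' -> cbmeas g' -> primitive f f' -> primitive g g' ->
  primitive (fun x => f x * g x) (fun x => f' x * g x + f x * g' x).
Proof.
move=> bf' bg' ff' gg'.
have bf := primitive_cbmeas bf' ff'; have bg := primitive_cbmeas bg' gg'.
have bh : cbmeas (fun x => f' x * g x + f x * g' x) by apply: cbmeasD; apply: cbmeasM.
have [K K1 Kf] := cbmeas_bound bf'; have [L L1 Lg] := cbmeas_bound bg'.
pose D x := f x * g x - cint (fun x => f' x * g x + f x * g' x) 0 x.
have lip (h h' : R -> R[i]) B a b : cbmeas h' -> primitive h h' ->
    (forall x, 0 <= x <= 1 -> N (h' x) <= B) -> 0 <= a -> a <= b -> b <= 1 ->
    N (h b - h a) <= B * (b - a).
  move=> bh' hh' hB a0 ab b1; rewrite (primitive_diff bh' hh') //.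
  apply: cint_bound => // x /andP[ax xb]; apply: hB.
  by rewrite (le_trans a0 ax) (le_trans xb b1).
have Dab a b : 0 <= a -> a <= b -> b <= 1 -> D b = D a.
  apply: (@subquadratic_const D (2 * (K * L))) => {}a {}b a0 ab b1.
  have e : D b - D a = cint (fun t => f' t * (g b - g t) + (f a - f t) * g' t) a b.
    rewrite /D (cint_split bh a0 ab b1).
    have e1 : f b * g b - f a * g a = g b * cint f' a b + f a * cint g' a b.
      rewrite -(primitive_diff bf' ff') // -(primitive_diff bg' gg') //; ring.
    transitivity ((f b * g b - f a * g a) - cint (fun x => f' x * g x + f x * g' x) a b).
      by ring.
    rewrite e1 -!cintZ // -cintD //; try exact: cbmeasZ.
    rewrite -cintB //; last by apply: cbmeasD; exact: cbmeasZ.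
    by apply: cint_eq => x _; ring.
  rewrite e expr2 mulrA; apply: cint_bound => //.
    by apply: cbmeasD; apply: cbmeasM => //; apply: cbmeasB => //; exact: cbmeas_cst.
  move=> t /andP[at_ tb].
  have t0 := le_trans a0 at_; have t1 := le_trans tb b1.
  have h1 := Kf t; have h2 := Lg t; rewrite t0 t1 in h1 h2.
  have {}h1 := h1 isT; have {}h2 := h2 isT.
  have h3 := lip _ _ _ _ _ bg' gg' Lg t0 tb b1.
  have h4 := lip _ _ _ _ _ bf' ff' Kf a0 at_ t1.
  rewrite l1normBC in h4.
  apply: le_trans (l1normD _ _) _.
  have h5 : N (f' t * (g b - g t)) <= K * (L * (b - a)).
    apply: le_trans (l1normM _ _) _; apply: ler_pM => //; try exact: l1norm_ge0.
    by apply: (le_trans h3); rewrite ler_wpM2l ?lerD2l ?lerN2 // (le_trans ler01).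
  have h6 : N ((f a - f t) * g' t) <= K * (b - a) * L.
    apply: le_trans (l1normM _ _) _; apply: ler_pM => //; try exact: l1norm_ge0.
    by apply: (le_trans h4); rewrite ler_wpM2l ?lerD2r // (le_trans ler01).
  lra.
move=> x /andP[x0 x1].
have := Dab 0 x (lexx _) x0 x1; rewrite /D cint_point subr0 => /eqP.
by rewrite subr_eq => /eqP.
Qed.
End ComplexIntegrals.

Local Notation N := l1norm.

(** * Normalised solutions of the boundary value problem *)

Section Solutions.
Variable R : realType.
Implicit Types (f g B : R -> R) (u p y : R -> R[i]) (k kappa z : R[i]) (a b x : R).

Lemma bmeas_Linf01 f : bmeas f -> Linf01 f.
Proof.
move=> [mf [M fM]]; rewrite /Linf01 inE /=; apply/andP; split; rewrite inE /=.
  apply/(measurable_restrictT f (measurable_itv _)).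
  apply: measurable_funS mf => //; exact: subset_itv_oo_cc.
rewrite /finite_norm unlock /=; case: ifPn => // _.
apply: (@le_lt_trans _ _ (Num.max 0 M)%:E); last exact: ltry.
apply/ess_supP; apply: nearW => x /=; rewrite lee_fin patchE.
case: ifPn => [|_]; last by rewrite normr0 le_max lexx.
rewrite inE /= in_itv /= => /andP[x0 x1].
by rewrite le_max fM ?orbT // !ltW.
Qed.

Lemma Linf01_measurable f : Linf01 f -> measurable_fun setT (f \_ (`]0, 1[ : set R)).
Proof. by move=> /sub_Lfun_mfun; rewrite inE. Qed.

Lemma ae_neq (c : R) : {ae leb R, forall x : R, x != c}.
Proof.
exists [set c]; split => //; first by rewrite lebesgue_measure_set1.
by move=> x /= /negP; rewrite negbK => /eqP.
Qed.

Lemma ae_imp (P Q : R -> Prop) : (forall x, P x -> Q x) ->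
  {ae leb R, forall x, P x} -> {ae leb R, forall x, Q x}.
Proof. by move=> PQ; apply: (@filterS _ _ (ae_filter_ringOfSetsType _)). Qed.

Lemma ae_imp2 (P Q S : R -> Prop) : (forall x, P x -> Q x -> S x) ->
  {ae leb R, forall x, P x} -> {ae leb R, forall x, Q x} -> {ae leb R, forall x, S x}.
Proof. by move=> PQ; apply: (@filterS2 _ _ (ae_filter_ringOfSetsType _)). Qed.

Lemma rint_ae_eq f g a b : measurable_fun (`[0, 1] : set R) f ->
  measurable_fun (`[0, 1] : set R) g ->
  {ae leb R, forall x, 0 < x < 1 -> f x = g x} ->
  0 <= a -> b <= 1 -> rint f a b = rint g a b.
Proof.
move=> mf mg fg a0 b1; rewrite /rint /Rintegral; congr fine.
have sab := @subitv01 _ _ _ a0 b1.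
apply: ae_eq_integral => //.
- by apply/measurable_EFinP; apply: measurable_funS mf.
- by apply/measurable_EFinP; apply: measurable_funS mg.
have := ae_imp2 (fun (x : R) h h' => conj h h') (ae_neq 0) (ae_neq 1).
apply: ae_imp2 fg => x fgx [x0 x1] /sab; rewrite /= in_itv /= => /andP[h0 h1].
by rewrite fgx // !lt_neqAle eq_sym x0 x1 h0 h1.
Qed.

Lemma primitive_cAC01 u p : cbmeas p -> primitive u p -> cAC01_deriv u p.
Proof.
move=> [rp jp] up; split; split.
- exact: bmeas_integrable.
- by move=> x x01; rewrite /cRe up // ReCD.
- exact: bmeas_integrable.
- by move=> x x01; rewrite /cIm up // ImCD.
Qed.

Lemma cAC01_primitive u p : cAC01_deriv u p -> primitive u p.
Proof.
move=> [[_ h1] [_ h2]] x x01; apply: complex_ext; rewrite ?ReCD ?ImCD /=.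
  exact: h1.
exact: h2.
Qed.

Lemma cAC01_cbmeas u p : cAC01_deriv u p -> cbmeas u.
Proof.
move=> [[i1 h1] [i2 h2]]; split.
  apply: bmeas_eq (bmeasD (bmeas_cst (cRe u 0)) (bmeas_rint i1)) => x x01.
  exact/esym/h1.
apply: bmeas_eq (bmeasD (bmeas_cst (cIm u 0)) (bmeas_rint i2)) => x x01.
exact/esym/h2.
Qed.

(** The equation [u'' = - k B u], [u'(0) = 0], as an integrated first-order system
for [u] and [p = u']; the bounds hold everywhere instead of almost everywhere. *)
Definition rsol k B u p : Prop :=
  [/\ bmeas B, cbmeas u, primitive u p, p 0 = 0
    & primitive p (fun t => - (k * (B t)%:C * u t))].

Lemma cbmeas_rhs k B u : bmeas B -> cbmeas u -> cbmeas (fun t => - (k * (B t)%:C * u t)).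
Proof.
move=> bB bu; apply: cbmeasN; apply: cbmeasM => //; apply: cbmeasZ; exact: cbmeasR.
Qed.

Lemma rsol_deriv_cbmeas k B u p : rsol k B u p -> cbmeas p.
Proof.
by move=> [bB bu _ _]; apply: primitive_cbmeas; exact: cbmeas_rhs.
Qed.

(** The condition [u(1) - i u'(1) / kappa = 0] without the division. *)
Definition radiating kappa u p : Prop := p 1 = - ((0 +i* 1) * kappa * u 1).

(** Allowing a second structure [B'] with [B' u = B u] almost everywhere is what
lets the same mode be read as a mode of its own bang-bang structure. *)
Lemma rsol_bvp kappa B B' u p : kappa != 0 -> rsol (kappa ^+ 2) B u p ->
  (exists2 x, 0 <= x <= 1 & u x != 0) -> radiating kappa u p ->
  {ae leb R, forall x, 0 < x < 1 -> (B x)%:C * u x = (B' x)%:C * u x} ->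
  bvp_solution kappa B' u.
Proof.
move=> k0 sol nz rad BB'; have bp := rsol_deriv_cbmeas sol.
have [bB bu up p0 pp] := sol; have bq := cbmeas_rhs (kappa ^+ 2) bB bu.
exists p, (fun t => - (kappa ^+ 2 * (B t)%:C * u t)); split => //.
- split; try exact: primitive_cAC01.
  by case: bq => ? ?; split; exact: bmeas_Linf01.
- apply: ae_imp BB' => x h x01; rewrite -!mulrA -h //; ring.
- rewrite rad; apply/eqP; rewrite subr_eq0 eq_sym -(inj_eq (mulIf k0)) divfK //.
  apply/eqP; have := @sqr_i R; rewrite expr2 => ii.
  by rewrite mulrN !mulrA ii mulN1r mulNr opprK mulrC.
Qed.

(** Clipping [B] to [[b1, b2]] changes it on a null set, and [- kappa ^ 2 B' y] is
then a bounded representative of the second derivative. *)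
Lemma bvp_rsol b1 b2 kappa B y : b1 <= b2 -> kappa != 0 -> Ad b1 b2 B ->
  bvp_solution kappa B y ->
  exists B' p, [/\ forall x, b1 <= B' x <= b2, rsol (kappa ^+ 2) B' y p,
    exists2 x, 0 <= x <= 1 & y x != 0 & radiating kappa y p].
Proof.
move=> b12 k0 [BL Bb] [y1 [y2 [[yy1 y12 [Ly2r Ly2i]] nz ode y10 rad]]].
(* Extension by 0 outside the open interval makes [B] measurable everywhere. *)
pose B' x := Num.max b1 (Num.min b2 ((B \_ (`]0, 1[ : set R)) x)).
have B'b x : b1 <= B' x <= b2.
  rewrite /B' le_max lexx /= ge_max b12 /=.
  by rewrite ge_min lexx.
have bB' : bmeas B'.
  split.
    apply: measurable_maxr; first exact: measurable_cst.
    apply: measurable_minr; first exact: measurable_cst.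
    by apply: measurable_funS (Linf01_measurable BL).
  exists (`|b1| + `|b2|) => x _; have /andP[h1 h2] := B'b x.
  rewrite ler_norml; have := ler_norm b2; have := ler_norm (- b1); rewrite normrN.
  by have := normr_ge0 b1; have := normr_ge0 b2 => *; apply/andP; split; lra.
have BB' : {ae leb R, forall x, 0 < x < 1 -> B' x = B x}.
  apply: ae_imp Bb => x h x01; have /andP[h1 h2] := h x01.
  by rewrite /B' patchE mem_set ?in_itv //= min_r // max_r.
have by_ := cAC01_cbmeas yy1.
have bq := cbmeas_rhs (kappa ^+ 2) bB' by_.
have yeq : {ae leb R, forall x, 0 < x < 1 -> y2 x = - (kappa ^+ 2 * (B' x)%:C * y x)}.
  apply: ae_imp2 ode BB' => x h1 h2 x01; rewrite h2 //.
  by apply/eqP; rewrite -addr_eq0 h1.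
have ym f : Linf01 f -> {ae leb R, forall x, 0 < x < 1 -> (f \_ (`]0, 1[ : set R)) x = f x}.
  by move=> _; apply: nearW => x x01; rewrite patchE mem_set ?in_itv.
exists B', y1; split => //.
  split => //; first exact: cAC01_primitive.
  move=> x /[dup] x01 /andP[x0 x1].
  have key f (g : R -> R) : bmeas g -> Linf01 f ->
     (leb R).-integrable `[0, 1] (EFin \o f) ->
     {ae leb R, forall x, 0 < x < 1 -> f x = g x} -> rint f 0 x = rint g 0 x.
    move=> [mg _] _ fi fg; apply: rint_ae_eq => //.
    by apply/measurable_EFinP; exact: measurable_int fi.
  case: y12 => -[i1 h1] [i2 h2].
  have {}h1 := h1 _ x01; have {}h2 := h2 _ x01.
  have [bq1 bq2] := bq.
  apply: complex_ext; rewrite ?ReCD ?ImCD /=.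
    rewrite -(key _ _ bq1 Ly2r i1) //.
    by apply: ae_imp yeq => t h t01; rewrite /cRe h.
  rewrite -(key _ _ bq2 Ly2i i2) //.
  by apply: ae_imp yeq => t h t01; rewrite /cIm h.
rewrite /radiating; have := @sqr_i R; rewrite expr2 => ii.
move/eqP: rad; rewrite subr_eq0 -(inj_eq (mulIf k0)) divfK // => /eqP e.
by rewrite -mulrA [kappa * _]mulrC e mulrA ii mulN1r opprK.
Qed.
End Solutions.

(** * Contractions and exponentially weighted integrals *)

Section Contraction.
Variable R : realType.

Lemma half_pow_small (c e : R) : 0 < e -> exists n : nat, c / 2 ^+ n <= e.
Proof.
move=> e0; exists (Num.truncn (c / e)).+1.
rewrite ler_pdivrMr ?exprn_gt0 // mulrC -ler_pdivrMr //.
apply/ltW/(lt_le_trans (truncnS_gt _)).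
by rewrite -natrX ler_nat ltnW // ltn_expl.
Qed.

(** The intervals of radius [2 c / 2 ^ n] around [s n] are nested. *)
Lemma geometric_limit (c : R) (s : nat -> R) :
  (forall n, `|s n - s n.+1| <= c / 2 ^+ n) ->
  exists l, forall n, `|s n - l| <= 2 * c / 2 ^+ n.
Proof.
move=> sc.
have hS n : 2 * c / 2 ^+ n.+1 = c / 2 ^+ n.
  by rewrite exprS; field; rewrite expf_neq0 // pnatr_eq0.
have h2 n : 2 * c / 2 ^+ n = c / 2 ^+ n + c / 2 ^+ n by ring.
have c0 n : 0 <= c / 2 ^+ n by apply: le_trans (sc n).
pose lo n := s n - 2 * c / 2 ^+ n; pose hi n := s n + 2 * c / 2 ^+ n.
have loS n : lo n <= lo n.+1.
  rewrite /lo hS h2; have := sc n; rewrite ler_norml => /andP[_ h]; lra.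
have hiS n : hi n.+1 <= hi n.
  rewrite /hi hS h2; have := sc n; rewrite ler_norml => /andP[h _]; lra.
have lohi n m : lo n <= hi m.
  have lo_hom : {homo lo : i j / (i <= j)%N >-> i <= j}.
    by apply: homo_leq => // x y v; exact: le_trans.
  have hi_hom : {homo hi : i j / (i <= j)%N >-> j <= i}.
    by apply: homo_leq => // x y v h1 h2'; exact: le_trans h2' h1.
  apply: le_trans (lo_hom _ _ (leq_maxl n m)) _.
  apply: le_trans (hi_hom _ _ (leq_maxr n m)).
  rewrite /lo /hi h2; have := c0 (maxn n m); lra.
pose S := range lo.
have S0 : S !=set0 by exists (lo 0%N), 0%N.
have Sub : has_ubound S by exists (hi 0%N) => _ [n _ <-].
exists (sup S) => n.
have h1 : lo n <= sup S by apply: ub_le_sup => //; exists n.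
have h3 : sup S <= hi n by apply: ge_sup => // _ [m _ <-].
rewrite ler_norml; rewrite /lo /hi in h1 h3; apply/andP; split; lra.
Qed.

Lemma geometric_limitC (c : R) (s : nat -> R[i]) :
  (forall n, N (s n - s n.+1) <= c / 2 ^+ n) ->
  exists l, forall n, N (s n - l) <= 4 * c / 2 ^+ n.
Proof.
move=> sc.
have [|a ha] := @geometric_limit c (fun n => Re (s n)).
  by move=> n; apply: le_trans (sc n); rewrite -ReCN -ReCD Re_le_l1norm.
have [|b hb] := @geometric_limit c (fun n => Im (s n)).
  by move=> n; apply: le_trans (sc n); rewrite -ImCN -ImCD Im_le_l1norm.
exists (a +i* b) => n; rewrite /N ReCD ImCD ReCN ImCN /=.
apply: le_trans (lerD (ha n) (hb n)) _; lra.
Qed.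

(** The distance is only a relation bounding from above, so that a product of
weighted sup norms can be used without constructing a normed space; for the same
reason the fixed point is obtained up to every positive [e]. *)
Lemma contraction_fixpoint (X : Type) (dist : X -> X -> R -> Prop)
    (dom : X -> Prop) (T : X -> X) (x0 : X) (c : R) :
  (forall x y d, dist x y d -> dist y x d) ->
  (forall x y v d e, dist x y d -> dist y v e -> dist x v (d + e)) ->
  (forall x, dom x -> dom (T x)) ->
  (forall x y d, dom x -> dom y -> dist x y d -> dist (T x) (T y) (d / 2)) ->
  (forall s, (forall n, dom (s n)) ->
     (forall n, dist (s n) (s n.+1) (c / 2 ^+ n)) ->
     exists2 l, dom l & forall n, dist (s n) l (4 * c / 2 ^+ n)) ->
  (forall x y d e, d <= e -> dist x y d -> dist x y e) ->
  dom x0 -> dist x0 (T x0) c ->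
  exists2 l, dom l & forall e, 0 < e -> dist (T l) l e.
Proof.
move=> sym tri domT contr compl mono dx0 d0.
pose s n := iter n T x0.
have ds n : dom (s n) by elim: n => //= n; exact: domT.
have ss n : dist (s n) (s n.+1) (c / 2 ^+ n).
  elim: n => [|n IH]; first by rewrite expr0 divr1.
  have := contr _ _ _ (ds n) (ds n.+1) IH.
  by rewrite exprS invfM mulrCA mulrC.
have [l dl hl] := compl s ds ss; exists l => // e e0.
have [n hn] := half_pow_small (4 * c) e0.
apply: (mono _ _ _ _ hn).
have h1 := contr _ _ _ (ds n) dl (hl n).
have h2 := hl n.+1.
have := tri _ _ _ _ _ (sym _ _ _ h1) h2.
rewrite exprS (_ : _ + _ = 4 * c / 2 ^+ n) //; field.
by rewrite expf_neq0 // pnatr_eq0.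
Qed.

Lemma cbmeas_limit (s : nat -> R -> R[i]) (f : R -> R[i]) (c : R) :
  (forall n, cbmeas (s n)) ->
  (forall n x, 0 <= x <= 1 -> N (s n x - f x) <= c / 2 ^+ n) -> cbmeas f.
Proof.
move=> bs sf.
have meas (F : R[i] -> R) : (forall z w, F (z - w) = F z - F w) ->
    (forall z, `|F z| <= N z) ->
    (forall n, bmeas (fun x => F (s n x))) -> bmeas (fun x => F (f x)).
  move=> FB FN bF; split.
    apply: (@measurable_fun_cvg _ _ R (`[0, 1] : set R) (fun n x => F (s n x))).
      by move=> n; have [] := bF n.
    move=> x; rewrite /= in_itv /= => x01.
    apply/cvgrPdist_le => e e0.
    have [n hn] := half_pow_small c e0.
    exists n => // m /= nm; rewrite distrC -FB.
    apply: le_trans (FN _) _; apply: le_trans (sf m x x01) _.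
    apply: le_trans hn; rewrite ler_wpM2l //.
      have := sf 0%N x x01; rewrite expr0 divr1; exact: le_trans (l1norm_ge0 _).
    by rewrite lef_pV2 ?posrE ?exprn_gt0 // ler_eXn2l // ltr1n.
  have [_ [M hM]] := bF 0%N; exists (c + M) => x x01.
  have := sf 0%N x x01; rewrite expr0 divr1 => h1.
  have := hM x x01 => h2; have := FN (s 0%N x - f x); rewrite FB => h3.
  have := le_trans h3 h1; have := ler_normB (F (s 0%N x)) (F (s 0%N x) - F (f x)).
  rewrite opprB addrCA subrr addr0; lra.
split; apply: meas.
- by move=> z w; rewrite ReCD ReCN.
- exact: Re_le_l1norm.
- by move=> n; have [] := bs n.
- by move=> z w; rewrite ImCD ImCN.
- exact: Im_le_l1norm.
- by move=> n; have [] := bs n.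
Qed.

(** Integration divides by [lam] the norm weighted by [expR (lam * t)]; this makes
the Volterra operator of the equation a contraction for large [lam]. *)
Lemma cint_weight (f : R -> R[i]) (lam D x : R) : cbmeas f -> 0 < lam -> 0 <= D ->
  (forall t, 0 <= t <= 1 -> N (f t) <= D * expR (lam * t)) -> 0 <= x <= 1 ->
  N (cint f 0 x) <= D / lam * expR (lam * x).
Proof.
move=> bf lam0 D0 fD /andP[x0 x1].
have be := bmeas_exp lam.
apply: le_trans (_ : rint (fun t => D * expR (lam * t)) 0 x <= _).
  apply: cint_norm => //; first exact: bmeasZ.
  by move=> t /andP[t0 tx]; apply: fD; rewrite t0 (le_trans tx x1).
rewrite rintZ // rint_exp ?gt_eqF // mulr0 expR0 -mulrA [_ / lam]mulrC.
rewrite ler_wpM2l // ler_pM2l ?invr_gt0 //; lra.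
Qed.
End Contraction.

(** * Persistence of the radiation condition under prescribed shifts *)

Section Persistence.
Variable R : realType.
Variables (kappa : R[i]) (B0 : R -> R) (u0 p0 : R -> R[i]) (W : R[i] -> R -> R) (C : R).
Hypothesis kappa0 : kappa != 0.
Hypothesis sol0 : rsol (kappa ^+ 2) B0 u0 p0.
Hypothesis rad0 : radiating kappa u0 p0.
Hypothesis u01 : u0 1 != 0.
Hypothesis C0 : 0 <= C.
Hypothesis W0 : forall x, W 0 x = 0.
Hypothesis bW : forall w, bmeas (W w).
Hypothesis lipW : forall w w' x, 0 <= x <= 1 -> `|W w x - W w' x| <= C * N (w - w').
Hypothesis intW : forall w, cint (fun t => (W w t)%:C * u0 t ^+ 2) 0 1 = w.

Let k0 := kappa ^+ 2.
Let A := k0^-1.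
Let bu0 : cbmeas u0. Proof. by case: sol0. Qed.
Let bp0 : cbmeas p0. Proof. exact: rsol_deriv_cbmeas sol0. Qed.
Let bB0 : bmeas B0. Proof. by case: sol0. Qed.

Let X : Type := ((R -> R[i]) * (R -> R[i]) * R[i])%type.

(** With [u = u0 + h] and [p = p0 + q], the system for [(u, p)] with parameter [k]
and structure [B0 + W w] reads [h' = q], [q' = - G k w h]. *)
Let G (k : R[i]) (w : R[i]) (h : R -> R[i]) : R -> R[i] := fun t =>
  k * ((B0 t)%:C * h t) + k * ((W w t)%:C * h t) + k * ((W w t)%:C * u0 t)
  + (k - k0) * ((B0 t)%:C * u0 t).

(** The first two components are the integrated system for [(h, q)]. The third is
[w - A * E], where [E = 0] is the Green identity combined with both radiation
conditions and [A = 1 / k0]. Since [int W w u0 ^ 2 = w], the term [w] cancels up to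
the small factor [A * (k - k0)]. *)
Let T (z : R[i]) (s : X) : X := let: (h, q, w) := s in
  let k := z ^+ 2 in
  (fun x => cint q 0 x,
   fun x => - cint (G k w h) 0 x,
   - (A * (k - k0) * w) - A * k * cint (fun t => (W w t)%:C * h t * u0 t) 0 1
   - A * (k - k0) * cint (fun t => (B0 t)%:C * (u0 t + h t) * u0 t) 0 1
   + A * ((0 +i* 1) * (z - kappa) * (u0 1 + h 1) * u0 1)).

Let dist (lam : R) (s s' : X) (d : R) : Prop :=
  [/\ forall x, 0 <= x <= 1 -> N (s.1.1 x - s'.1.1 x) <= d * expR (lam * x),
      forall x, 0 <= x <= 1 -> N (s.1.2 x - s'.1.2 x) <= d * expR (lam * x)
    & N (s.2 - s'.2) <= d].

Let zero : X := (fun=> 0, fun=> 0, 0).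

Let dom (lam r : R) (s : X) : Prop :=
  [/\ cbmeas s.1.1, cbmeas s.1.2 & dist lam zero s r].

Let bG k w h : cbmeas h -> cbmeas (G k w h).
Proof.
move=> bh; have bRM (f : R -> R) g : bmeas f -> cbmeas g -> cbmeas (fun t => (f t)%:C * g t).
  by move=> bf bg; apply: cbmeasM => //; exact: cbmeasR.
by rewrite /G; repeat apply: cbmeasD; apply: cbmeasZ; apply: bRM.
Qed.

Let dist_sym lam x y d : dist lam x y d -> dist lam y x d.
Proof.
by move=> [h1 h2 h3]; split => [t t01|t t01|]; rewrite l1normBC ?h1 ?h2.
Qed.

Let dist_tri lam x y v d e : dist lam x y d -> dist lam y v e -> dist lam x v (d + e).
Proof.
have NB (a b c : R[i]) (d' e' : R) : N (a - b) <= d' -> N (b - c) <= e' -> N (a - c) <= d' + e'.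
  by move=> ab bc; have := l1norm_add_le ab bc; rewrite addrA subrK.
move=> [h1 h2 h3] [g1 g2 g3]; split => [t t01|t t01|]; rewrite ?mulrDl.
- by apply: NB; [exact: h1|exact: g1].
- by apply: NB; [exact: h2|exact: g2].
- by apply: NB; [exact: h3|exact: g3].
Qed.

Let dist_mono lam x y d e : d <= e -> dist lam x y d -> dist lam x y e.
Proof.
move=> de [h1 h2 h3]; split => [t t01|t t01|]; last exact: le_trans de.
- by apply: le_trans (h1 t t01) _; rewrite ler_wpM2r ?expR_ge0.
- by apply: le_trans (h2 t t01) _; rewrite ler_wpM2r ?expR_ge0.
Qed.

Let dist_le lam x y d : (forall e, 0 < e -> dist lam x y (d + e)) -> dist lam x y d.
Proof.
move=> h; split => [t t01|t t01|]; apply/ler_addgt0Pr => e e0.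
- have E := expR_gt0 (lam * t); have [/(_ t t01) + _ _] := h (e / expR (lam * t)) (divr_gt0 e0 E).
  by rewrite mulrDl divfK ?gt_eqF.
- have E := expR_gt0 (lam * t); have [_ /(_ t t01) + _] := h (e / expR (lam * t)) (divr_gt0 e0 E).
  by rewrite mulrDl divfK ?gt_eqF.
- by have [] := h e e0.
Qed.

Let dist_complete lam r c (s : nat -> X) : 0 <= lam -> (forall n, dom lam r (s n)) ->
  (forall n, dist lam (s n) (s n.+1) (c / 2 ^+ n)) ->
  exists2 l, dom lam r l & forall n, dist lam (s n) l (4 * c / 2 ^+ n).
Proof.
move=> lam0 ds ss.
have E x : 0 < expR (lam * x) by exact: expR_gt0.
have comp (f : X -> R -> R[i]) : (forall n x, 0 <= x <= 1 ->
      N (f (s n) x - f (s n.+1) x) <= c / 2 ^+ n * expR (lam * x)) ->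
    exists F, forall n x, 0 <= x <= 1 -> N (f (s n) x - F x) <= 4 * c / 2 ^+ n * expR (lam * x).
  move=> fs.
  have /choice[F HF] x : exists l, 0 <= x <= 1 -> forall n,
      N (f (s n) x - l) <= 4 * c / 2 ^+ n * expR (lam * x).
    have [x01|] := boolP (0 <= x <= 1); last by exists 0.
    have [|l hl] := @geometric_limitC _ (c * expR (lam * x)) (fun n => f (s n) x).
      by move=> n; rewrite mulrAC; exact: fs.
    exists l => _ n; rewrite (_ : 4 * c / 2 ^+ n * _ = 4 * (c * expR (lam * x)) / 2 ^+ n) //; ring.
  by exists F => n x x01; exact: HF.
have [h hh] := comp (fun v => v.1.1) (fun n x x01 => let: And3 a _ _ := ss n in a x x01).
have [q hq] := comp (fun v => v.1.2) (fun n x x01 => let: And3 _ a _ := ss n in a x x01).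
have [w hw] := @geometric_limitC _ c (fun n => (s n).2) (fun n => let: And3 _ _ a := ss n in a).
have sl n : dist lam (s n) (h, q, w) (4 * c / 2 ^+ n).
  by split => [x x01|x x01|]; [exact: hh|exact: hq|exact: hw].
have c0 : 0 <= c.
  by have [_ _ ] := ss 0%N; rewrite expr0 divr1; exact: le_trans (l1norm_ge0 _).
exists (h, q, w) => //; split.
- apply: (@cbmeas_limit _ (fun n => (s n).1.1) _ (4 * c * expR lam)).
    by move=> n; have [] := ds n.
  move=> n x x01; rewrite mulrAC; apply: le_trans (hh n x x01) _.
  rewrite ler_wpM2l ?divr_ge0 ?mulr_ge0 ?exprn_ge0 // ler_expR.
  by have /andP[_ x1] := x01; rewrite ler_piMr.
- apply: (@cbmeas_limit _ (fun n => (s n).1.2) _ (4 * c * expR lam)).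
    by move=> n; have [] := ds n.
  move=> n x x01; rewrite mulrAC; apply: le_trans (hq n x x01) _.
  rewrite ler_wpM2l ?divr_ge0 ?mulr_ge0 ?exprn_ge0 // ler_expR.
  by have /andP[_ x1] := x01; rewrite ler_piMr.
- apply: dist_le => e e0; have [n hn] := half_pow_small (4 * c) e0.
  apply: dist_tri (dist_mono hn (sl n)).
  by have [] := ds n.
Qed.

(** The weight [lam] controls the component [q], the radius [r] the terms that are
quadratic in [(h, w)], and the bound [eta] on [z - kappa] and [z ^ 2 - k0] the
remaining terms of the third component. *)
Let T_contr (z : R[i]) M lam r eta d : 1 <= M ->
  (forall x, 0 <= x <= 1 -> N (u0 x) <= M) -> (forall x, 0 <= x <= 1 -> `|B0 x| <= M) ->
  C <= M -> N A <= M -> N (z ^+ 2) <= M -> N (z - kappa) <= eta -> N (z ^+ 2 - k0) <= eta ->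
  8 * M ^+ 3 <= lam -> 0 < r -> r * (16 * M ^+ 4 * expR lam) <= 1 ->
  eta * (8 * M ^+ 4 * expR lam) <= r -> 0 <= d ->
  forall s s', dom lam r s -> dom lam r s' -> dist lam s s' d ->
    dist lam (T z s) (T z s') (d / 2).
Proof.
move=> M1 uM BM CM AM kM zk kk lamM r0 rM etaM d0 [[h q] w] [[h' q'] w'].
move=> [/= bh bq [/= hr qr wr]] [/= bh' bq' [/= hr' qr' wr']] [/= hd qd wd].
set k := z ^+ 2 in kM kk *; set L := expR lam in rM etaM.
have M0 : 0 < M := lt_le_trans ltr01 M1.
have P n : 1 <= M ^+ n by rewrite exprn_ege1.
have P0 n : 0 <= M ^+ n := le_trans ler01 (P n).
have lam0 : 0 < lam by apply: lt_le_trans lamM; have := P 3%N; lra.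
have L1 : 1 <= L by rewrite -expR0 ler_expR ltW.
have L0 : 0 <= L := le_trans ler01 L1.
have eta0 : 0 <= eta := le_trans (l1norm_ge0 _) zk.
have P4L : 1 <= M ^+ 4 * L by have := ler_pM ler01 ler01 (P 4%N) L1; rewrite mulr1.
have r1 : r <= 1.
  apply: le_trans rM; rewrite ler_peMr ?ltW //; lra.
have eta_r : eta * (M ^+ 4 * L) <= 1 / 8 by lra.
have E1 t : 0 <= t -> 1 <= expR (lam * t).
  by move=> t0; rewrite -expR0 ler_expR mulr_ge0 // ltW.
have EL t : 0 <= t <= 1 -> expR (lam * t) <= L.
  by move=> /andP[t0 t1]; rewrite ler_expR ler_piMr // ltW.
have BM' t : 0 <= t <= 1 -> N (B0 t)%:C <= M by move=> t01; rewrite l1normR BM.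
have WM t : 0 <= t <= 1 -> N (W w t)%:C <= M * r.
  move=> t01; rewrite l1normR; have := lipW w 0 t01; rewrite W0 !subr0 => h1.
  apply: le_trans h1 _; rewrite l1normBC subr0 in wr.
  by apply: ler_pM => //; exact: l1norm_ge0.
have WD t : 0 <= t <= 1 -> N ((W w t)%:C - (W w' t)%:C) <= M * d.
  move=> t01; rewrite -rmorphB /= l1normR; apply: le_trans (lipW _ _ t01) _.
  by apply: ler_pM => //; exact: l1norm_ge0.
have hr'2 t : 0 <= t <= 1 -> N (h' t) <= r * expR (lam * t).
  by move=> t01; rewrite -[h' t]subr0 l1normBC hr'.
have i01 : 0 <= (1 : R) <= 1 by apply/andP; split.
have dL t : 0 <= t <= 1 -> N (h t - h' t) <= d * L.
  by move=> t01; apply: le_trans (hd t t01) _; rewrite ler_wpM2l ?EL.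
split => /=.
- move=> x x01; have /andP[x0 x1] := x01.
  rewrite -cintB //.
  apply: le_trans (cint_weight (cbmeasB bq bq') lam0 d0 qd x01) _.
  rewrite ler_wpM2r ?expR_ge0 // ler_wpM2l // lef_pV2 ?posrE //.
  by apply: le_trans lamM; have := P 3%N; lra.
- move=> x x01; have /andP[x0 x1] := x01.
  rewrite -opprB opprK addrC -cintB ?l1normN //; try exact: bG.
  have D0 : 0 <= 4 * M ^+ 3 * d by exact: (mulr_ge0 (mulr_ge0 (ler0n _ 4) (P0 3%N)) d0).
  have bGG := cbmeasB (bG k w bh) (bG k w' bh').
  apply: le_trans (cint_weight bGG lam0 D0 _ x01) _.
    move=> t t01.
    have -> : G k w h t - G k w' h' t =
        k * ((B0 t)%:C * (h t - h' t)) + k * ((W w t)%:C * (h t - h' t))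
        + k * (((W w t)%:C - (W w' t)%:C) * h' t) + k * (((W w t)%:C - (W w' t)%:C) * u0 t).
      rewrite /G; ring.
    have t0 : 0 <= t by case/andP: t01.
    have e1 := l1norm_mul_le kM (l1norm_mul_le (BM' t t01) (hd t t01)).
    have e2 := l1norm_mul_le kM (l1norm_mul_le (WM t t01) (hd t t01)).
    have e3 := l1norm_mul_le kM (l1norm_mul_le (WD t t01) (hr'2 t t01)).
    have e4 := l1norm_mul_le kM (l1norm_mul_le (WD t t01) (uM t t01)).
    apply: le_trans (l1norm_add_le (l1norm_add_le (l1norm_add_le e1 e2) e3) e4) _.
    have := E1 t t0; set E := expR _ => EE.
    have E0 : 0 <= E := le_trans ler01 EE.
    have dE : 0 <= M ^+ 2 * d * E by exact: (mulr_ge0 (mulr_ge0 (P0 2%N) d0) E0).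
    have dM : 0 <= M ^+ 3 * d by exact: (mulr_ge0 (P0 3%N) d0).
    have i1 : M * (M * (d * E)) <= M ^+ 3 * d * E.
      rewrite (_ : M * (M * (d * E)) = M ^+ 2 * d * E); last ring.
      rewrite (_ : M ^+ 3 * d * E = M ^+ 2 * d * E * M); last ring.
      by rewrite ler_peMr.
    have i2 : M * (M * r * (d * E)) <= M ^+ 3 * d * E.
      apply: le_trans i1; rewrite (_ : M * (M * r * (d * E)) = M * (M * (d * E)) * r); last ring.
      by rewrite ler_piMr // !mulr_ge0 // ltW.
    have i3 : M * (M * d * (r * E)) <= M ^+ 3 * d * E.
      by rewrite (_ : M * (M * d * (r * E)) = M * (M * r * (d * E))) //; ring.
    have i4 : M * (M * d * M) <= M ^+ 3 * d * E.
      rewrite (_ : M * (M * d * M) = M ^+ 3 * d); last ring.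
      by rewrite ler_peMr.
    lra.
  rewrite ler_wpM2r ?expR_ge0 // ler_pdivrMr //.
  have := ler_wpM2l d0 lamM; lra.
- have bRM (f : R -> R) g : bmeas f -> cbmeas g -> cbmeas (fun t => (f t)%:C * g t).
    by move=> bf bg; apply: cbmeasM => //; exact: cbmeasR.
  have b1 : cbmeas (fun t => (W w t)%:C * h t * u0 t) by apply: cbmeasM => //; exact: bRM.
  have b1' : cbmeas (fun t => (W w' t)%:C * h' t * u0 t) by apply: cbmeasM => //; exact: bRM.
  have b2 : cbmeas (fun t => (B0 t)%:C * (u0 t + h t) * u0 t).
    by apply: cbmeasM => //; apply: bRM => //; exact: cbmeasD.
  have b2' : cbmeas (fun t => (B0 t)%:C * (u0 t + h' t) * u0 t).
    by apply: cbmeasM => //; apply: bRM => //; exact: cbmeasD.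
  set I1 := cint _ 0 1; set I2 := cint _ 0 1; set I1' := cint _ 0 1; set I2' := cint _ 0 1.
  have -> : - (A * (k - k0) * w) - A * k * I1 - A * (k - k0) * I2
     + A * ('i%C * (z - kappa) * (u0 1 + h 1) * u0 1) -
     (- (A * (k - k0) * w') - A * k * I1' - A * (k - k0) * I2'
     + A * ('i%C * (z - kappa) * (u0 1 + h' 1) * u0 1)) =
     - (A * (k - k0) * (w - w')) - A * k * (I1 - I1') - A * (k - k0) * (I2 - I2')
     + A * ('i%C * (z - kappa) * (h 1 - h' 1) * u0 1) by ring.
  have J1 : N (I1 - I1') <= 2 * (M ^+ 2 * (r * d * L)).
    rewrite -cintB //; apply: cint01_bound; first exact: cbmeasB.
    move=> t t01.
    have -> : (W w t)%:C * h t * u0 t - (W w' t)%:C * h' t * u0 t =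
       (W w t)%:C * (h t - h' t) * u0 t + ((W w t)%:C - (W w' t)%:C) * h' t * u0 t by ring.
    have e1 := l1norm_mul_le (l1norm_mul_le (WM t t01) (dL t t01)) (uM t t01).
    have hL : N (h' t) <= r * L.
      by apply: le_trans (hr'2 t t01) _; rewrite ler_wpM2l ?EL // ltW.
    have e2 := l1norm_mul_le (l1norm_mul_le (WD t t01) hL) (uM t t01).
    apply: le_trans (l1norm_add_le e1 e2) _; apply: le_of_eq; ring.
  have J2 : N (I2 - I2') <= M ^+ 2 * (d * L).
    rewrite -cintB //; apply: cint01_bound; first exact: cbmeasB.
    move=> t t01.
    have -> : (B0 t)%:C * (u0 t + h t) * u0 t - (B0 t)%:C * (u0 t + h' t) * u0 t =
       (B0 t)%:C * (h t - h' t) * u0 t by ring.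
    have e1 := l1norm_mul_le (l1norm_mul_le (BM' t t01) (dL t t01)) (uM t t01).
    apply: le_trans e1 _; apply: le_of_eq; ring.
  have Ni : N ('i%C : R[i]) <= 1 by rewrite l1normi.
  have e1 := l1norm_mul_le (l1norm_mul_le AM kk) wd.
  have e2 := l1norm_mul_le (l1norm_mul_le AM kM) J1.
  have e3 := l1norm_mul_le (l1norm_mul_le AM kk) J2.
  have e4 := l1norm_mul_le AM (l1norm_mul_le (l1norm_mul_le (l1norm_mul_le Ni zk) (dL 1 i01)) (uM 1 i01)).
  rewrite -l1normN in e1.
  apply: le_trans (l1norm_add_le (l1norm_sub_le (l1norm_sub_le e1 e2) e3) e4) _.
  have q0 : 0 <= eta * d by rewrite mulr_ge0.
  have i2 : r * M ^+ 4 * L * d <= 1 / 16 * d by rewrite ler_wpM2r //; lra.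
  have i3 : eta * M ^+ 4 * L * d <= 1 / 8 * d by rewrite ler_wpM2r //; lra.
  have i4 : M * eta * d <= eta * M ^+ 4 * L * d.
    rewrite (_ : eta * M ^+ 4 * L * d = M * eta * d * (M ^+ 3 * L)); last ring.
    rewrite ler_peMr ?(mulr_ge0 (mulr_ge0 (ltW M0) eta0) d0) //.
    by have := ler_pM ler01 ler01 (P 3%N) L1; rewrite mulr1.
  have i5 : M * eta * (M ^+ 2 * (d * L)) <= eta * M ^+ 4 * L * d.
    rewrite (_ : eta * M ^+ 4 * L * d = M * eta * (M ^+ 2 * (d * L)) * M); last ring.
    by rewrite ler_peMr // !mulr_ge0 // ltW.
  have i6 : M * (1 * eta * (d * L) * M) <= eta * M ^+ 4 * L * d.
    rewrite (_ : eta * M ^+ 4 * L * d = M * (1 * eta * (d * L) * M) * M ^+ 2); last ring.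
    by rewrite ler_peMr // !mulr_ge0 // ltW.
  lra.
Qed.

(** At the unperturbed mode the system is violated only by terms carrying a factor
[z - kappa] or [k - k0]. *)
Let T_zero (z : R[i]) M lam r eta : 1 <= M -> 0 <= lam ->
  (forall x, 0 <= x <= 1 -> N (u0 x) <= M) -> (forall x, 0 <= x <= 1 -> `|B0 x| <= M) ->
  N A <= M -> N (z - kappa) <= eta -> N (z ^+ 2 - k0) <= eta ->
  eta * (4 * M ^+ 4) <= r ->
  dist lam zero (T z zero) (r / 2).
Proof.
move=> M1 lam0 uM BM AM zk kk etaM.
set k := z ^+ 2 in kk *.
have M0 : 0 < M := lt_le_trans ltr01 M1.
have P n : 1 <= M ^+ n by rewrite exprn_ege1.
have P0 n : 0 <= M ^+ n := le_trans ler01 (P n).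
have eta0 : 0 <= eta := le_trans (l1norm_ge0 _) zk.
have r0 : 0 <= r by apply: le_trans etaM; apply: mulr_ge0 => //; apply: mulr_ge0.
have BM' t : 0 <= t <= 1 -> N (B0 t)%:C <= M by move=> t01; rewrite l1normR BM.
have i01 : 0 <= (1 : R) <= 1 by apply/andP; split.
have bz : cbmeas (fun=> 0 : R[i]) by exact: cbmeas_cst.
have c0 (x : R) : cint (fun=> 0 : R[i]) 0 x = 0 by rewrite /cint /rint /Rintegral !integral0.
have E1 t : 0 <= t -> 1 <= expR (lam * t).
  by move=> t0; rewrite -expR0 ler_expR mulr_ge0.
have eM2 : eta * M ^+ 2 <= eta * M ^+ 4.
  by rewrite ler_wpM2l // (_ : M ^+ 4 = M ^+ 2 * M ^+ 2) ?ler_peMr // -exprD.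
have eM3 : eta * M ^+ 3 <= eta * M ^+ 4.
  by rewrite ler_wpM2l // (_ : M ^+ 4 = M ^+ 3 * M) ?ler_peMr // -exprSr.
split => /=.
- by move=> x x01; rewrite c0 subrr l1norm0 mulr_ge0 ?divr_ge0 ?expR_ge0.
- move=> x /[dup] x01 /andP[x0 x1]; rewrite sub0r opprK.
  have := cint_bound (bG k 0 bz) (lexx 0) x0 x1 (M := eta * M ^+ 2).
  rewrite subr0 => h; apply: le_trans (h _) _.
    move=> t /andP[t0 tx]; rewrite /G W0 !(mulr0, mul0r) !add0r.
    have t01 : 0 <= t <= 1 by rewrite t0 (le_trans tx x1).
    apply: le_trans (l1norm_mul_le kk (l1norm_mul_le (BM' t t01) (uM t t01))) _.
    by rewrite expr2.
  apply: le_trans (_ : r / 2 * 1 <= _); last first.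
    by rewrite ler_wpM2l ?E1 // divr_ge0.
  apply: le_trans (_ : eta * M ^+ 2 * 1 <= _).
    by rewrite ler_wpM2l // mulr_ge0.
  lra.
- set I1 := cint _ 0 1; set I2 := cint _ 0 1.
  have -> : I1 = 0 by rewrite /I1 -[RHS](c0 1); apply: cint_eq => x _; rewrite W0 !mul0r.
  have J2 : N I2 <= M * M * M.
    apply: cint01_bound.
      by apply: cbmeasM => //; apply: cbmeasM; [exact: cbmeasR|exact: cbmeasD].
    by move=> t t01; rewrite addr0; apply: l1norm_mul_le (l1norm_mul_le (BM' t t01) (uM t t01)) (uM t t01).
  have -> : 0 - (- (A * (k - k0) * 0) - A * k * 0 - A * (k - k0) * I2
     + A * ('i%C * (z - kappa) * (u0 1 + 0) * u0 1)) =
     A * (k - k0) * I2 - A * ('i%C * (z - kappa) * u0 1 * u0 1) by ring.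
  have Ni : N ('i%C : R[i]) <= 1 by rewrite l1normi.
  have e1 := l1norm_mul_le (l1norm_mul_le AM kk) J2.
  have e2 := l1norm_mul_le AM (l1norm_mul_le (l1norm_mul_le (l1norm_mul_le Ni zk) (uM 1 i01)) (uM 1 i01)).
  apply: le_trans (l1norm_sub_le e1 e2) _.
  rewrite (_ : _ + _ = eta * M ^+ 4 + eta * M ^+ 3); last ring.
  lra.
Qed.

(** Every [z] near [kappa] becomes a quasi-eigenvalue after a small modification
[W w] of the structure. The condition [u 1 != 0] certifies that the new mode is
not zero: it stays close to [u0]. *)
Lemma persistence (r0 : R) : 0 < r0 ->
  exists2 delta, 0 < delta & forall z, N (z - kappa) <= delta ->
    exists w u p, [/\ N w <= r0, rsol (z ^+ 2) (fun x => B0 x + W w x) u p,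
      radiating z u p & u 1 != 0].
Proof.
move=> r00.
have [M1 hM1 uM1] := cbmeas_bound bu0.
have [M2 BM2] := bB0.2.
(* One constant that bounds all data, so that the later choices depend on it only. *)
pose M := M1 + `|M2| + C + N A + (N kappa + 1) ^+ 2.
have nA := l1norm_ge0 A; have nk := l1norm_ge0 kappa; have nM2 := normr_ge0 M2.
have nkk : 0 <= N kappa ^+ 2 by rewrite exprn_ge0.
have sq : (N kappa + 1) ^+ 2 = N kappa ^+ 2 + 2 * N kappa + 1 by ring.
have C0' : 0 <= C by exact: C0.
have M1M : M1 <= M by rewrite /M sq; lra.
have M1' : 1 <= M by lra.
have M0 : 0 < M by lra.
have uM x : 0 <= x <= 1 -> N (u0 x) <= M by move=> x01; apply: le_trans (uM1 x x01) _.
have BM x : 0 <= x <= 1 -> `|B0 x| <= M.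
  move=> x01; apply: le_trans (BM2 x x01) _; have := ler_norm M2; rewrite /M sq; lra.
have CM : C <= M by rewrite /M sq; lra.
have AM : N A <= M by rewrite /M sq; lra.
have kM : (N kappa + 1) ^+ 2 <= M by rewrite /M sq; lra.
have P n : 1 <= M ^+ n by rewrite exprn_ege1.
have P0 n : 0 <= M ^+ n := le_trans ler01 (P n).
pose lam := 8 * M ^+ 3.
have lam0 : 0 <= lam by exact: mulr_ge0.
pose L := expR lam.
have L1 : 1 <= L by rewrite -expR0 ler_expR.
have L0 : 0 < L := lt_le_trans ltr01 L1.
have P4L : 1 <= M ^+ 4 * L by have := ler_pM ler01 ler01 (P 4%N) L1; rewrite mulr1.
have u1pos : 0 < N (u0 1).
  rewrite lt_neqAle l1norm_ge0 andbT eq_sym; apply/eqP => u10.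
  by move: u01; rewrite (l1norm_eq0 (z := u0 1)) ?u10 ?eqxx.
(* The last bound keeps [h 1] smaller than [u0 1]. *)
pose r := Num.min r0 (Num.min (1 / (16 * M ^+ 4 * L)) (N (u0 1) / (2 * L))).
have q0 : 0 < 16 * M ^+ 4 * L by apply: mulr_gt0 => //; apply: mulr_gt0 => //; exact: lt_le_trans (P 4%N).
have rpos : 0 < r by rewrite !lt_min r00 !divr_gt0 // mulr_gt0.
have rr0 : r <= r0 by rewrite ge_min lexx.
have rM : r * (16 * M ^+ 4 * L) <= 1.
  by rewrite -ler_pdivlMr // !ge_min lexx orbT.
have ru : r * (2 * L) <= N (u0 1).
  by rewrite -ler_pdivlMr ?mulr_gt0 // !ge_min lexx !orbT.
pose eta := r / (8 * M ^+ 4 * L).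
have q1 : 0 < 8 * M ^+ 4 * L by lra.
have etaM : eta * (8 * M ^+ 4 * L) <= r by rewrite /eta divfK // gt_eqF.
have eta0 : 0 < eta by rewrite divr_gt0.
have eta1 : eta <= 1.
  rewrite /eta ler_pdivrMr // mul1r; apply: le_trans (_ : 1 <= _); last lra.
  apply: le_trans rM; rewrite ler_peMr ?ltW //; lra.
exists (eta / M) => [|z zk]; first exact: divr_gt0.
have dM : eta / M <= eta by rewrite ler_pdivrMr // ler_peMr // ltW.
have zk' : N (z - kappa) <= eta := le_trans zk dM.
have zN : N z <= N kappa + 1.
  rewrite -[z](subrK kappa) addrC; apply: l1norm_add_le => //; exact: le_trans zk' eta1.
have kM' : N (z ^+ 2) <= M.
  by apply: le_trans kM; rewrite expr2; apply: l1norm_mul_le.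
have kk : N (z ^+ 2 - k0) <= eta.
  rewrite /k0 subr_sqr; have e1 : N (z + kappa) <= M.
    apply: le_trans (l1normD _ _) _; move: zN kM; rewrite sq; lra.
  apply: le_trans (l1norm_mul_le zk e1) _; by rewrite divfK // gt_eqF.
have etaM4 : eta * (4 * M ^+ 4) <= r.
  apply: le_trans etaM; rewrite ler_wpM2l 1?ltW //.
  have : M ^+ 4 <= M ^+ 4 * L by rewrite ler_peMr.
  have := P0 4%N; lra.
have dT0 := T_zero M1' lam0 uM BM AM zk' kk etaM4.
have contr d s s' : 0 <= d -> dom lam r s -> dom lam r s' -> dist lam s s' d ->
    dist lam (T z s) (T z s') (d / 2).
  move=> d0 ds ds'.
  exact: (T_contr M1' uM BM CM AM kM' zk' kk (lexx _) rpos rM etaM d0 ds ds').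
have dist_pos s s' d : dist lam s s' d -> 0 <= d.
  by move=> [_ _]; exact: le_trans (l1norm_ge0 _).
have dom0 : dom lam r zero.
  split; [exact: cbmeas_cst|exact: cbmeas_cst|split => [x _|x _|]] => /=;
    by rewrite subrr l1norm0 ?mulr_ge0 ?expR_ge0 // ltW.
have domT s : dom lam r s -> dom lam r (T z s).
  move=> ds; have [bh bq dr] := ds; split.
  - by case: (s) bh bq => -[h q] w /= bh bq; exact: cbmeas_cint.
  - case: (s) bh bq => -[h q] w /= bh bq.
    by apply: cbmeasN; apply: cbmeas_cint; exact: bG.
  - have := dist_tri dT0 (contr _ _ _ (ltW rpos) dom0 ds dr).
    by apply: dist_mono; lra.
have [[[h q] w] [/= bh bq dr] fix_] := @contraction_fixpoint R X (dist lam) (dom lam r) (T z) zero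
  (r / 2) (@dist_sym lam) (@dist_tri lam) domT
  (fun s s' d ds ds' dd => contr d s s' (dist_pos _ _ _ dd) ds ds' dd)
  (fun s ds ss => dist_complete lam0 ds ss) (@dist_mono lam) dom0 dT0.
have feq (f g : R[i]) (a : R) : 0 < a -> (forall e, 0 < e -> N (f - g) <= e * a) -> f = g.
  move=> a0 fg; apply/eqP; rewrite -subr_eq0; apply/eqP/l1norm_eq0.
  apply/ler_addgt0Pr => e e0; rewrite add0r.
  by have := fg (e / a) (divr_gt0 e0 a0); rewrite divfK // gt_eqF.
have h_eq x : 0 <= x <= 1 -> cint q 0 x = h x.
  move=> x01; apply: (feq _ _ (expR (lam * x))); first exact: expR_gt0.
  by move=> e e0; have [/(_ x x01)] := fix_ e e0.
have q_eq x : 0 <= x <= 1 -> - cint (G (z ^+ 2) w h) 0 x = q x.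
  move=> x01; apply: (feq _ _ (expR (lam * x))); first exact: expR_gt0.
  by move=> e e0; have [_ /(_ x x01)] := fix_ e e0.
have w_eq : (T z (h, q, w)).2 = w.
  apply: (feq _ _ 1); first exact: ltr01.
  by move=> e e0; have [_ _] := fix_ e e0; rewrite mulr1.
have [dh _ dw] := dr; rewrite /= in dh dw.
have i01 : 0 <= (1 : R) <= 1 by apply/andP; split.
have i00 : 0 <= (0 : R) <= 1 by apply/andP; split.
pose u x := u0 x + h x; pose p x := p0 x + q x.
have bu : cbmeas u by exact: cbmeasD.
have bp : cbmeas p by exact: cbmeasD.
have [_ _ pu0 p00 pp0] := sol0.
have bBW : bmeas (fun x => B0 x + W w x) by exact: bmeasD.
have h00 : h 0 = 0 by rewrite -h_eq // cint_point.
have q00 : q 0 = 0 by rewrite -q_eq // cint_point oppr0.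
set k := z ^+ 2 in kM' kk q_eq w_eq *.
have sol : rsol k (fun x => B0 x + W w x) u p.
  split => //.
  - move=> x /[dup] x01 /andP[x0 x1].
    by rewrite /u h00 addr0 -h_eq // pu0 // -addrA cintD.
  - by rewrite /p p00 q00 addr0.
  - move=> x /[dup] x01 /andP[x0 x1].
    rewrite /p q00 p00 addr0 add0r -q_eq // pp0 // p00 add0r -cintN //; last exact: bG.
    have b0 := cbmeas_rhs k0 bB0 bu0; have bGN := cbmeasN (bG k w bh).
    rewrite -cintD //; apply: cint_eq => t _; rewrite /G /u /k0 rmorphD /=; ring.
exists w, u, p; split => //.
- by apply: le_trans rr0; rewrite sub0r l1normN in dw.
- have bWu : cbmeas (fun t => (W w t)%:C * u t * u0 t).
    by apply: cbmeasM => //; apply: cbmeasM => //; exact: cbmeasR.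
  have bWh : cbmeas (fun t => (W w t)%:C * h t * u0 t).
    by apply: cbmeasM => //; apply: cbmeasM => //; exact: cbmeasR.
  have bBu : cbmeas (fun t => (B0 t)%:C * u t * u0 t).
    by apply: cbmeasM => //; apply: cbmeasM => //; exact: cbmeasR.
  have bW2 : cbmeas (fun t => (W w t)%:C * u0 t ^+ 2).
    by apply: cbmeasM; [exact: cbmeasR|exact: cbmeasM].
  have Wu : w + cint (fun t => (W w t)%:C * h t * u0 t) 0 1 =
      cint (fun t => (W w t)%:C * u t * u0 t) 0 1.
    rewrite -{1}(intW w) -cintD //; apply: cint_eq => t _; rewrite /u; ring.
  have Ak0 : A * k0 = 1 by rewrite mulVf // expf_neq0.
  (* The third fixed-point equation, multiplied by [k0]. *)
  have key : k * cint (fun t => (W w t)%:C * u t * u0 t) 0 1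
      + (k - k0) * cint (fun t => (B0 t)%:C * u t * u0 t) 0 1
      = 'i%C * (z - kappa) * u 1 * u0 1.
    rewrite -Wu; move: w_eq; rewrite /T /= -/k -/(u 1).
    set I1 := cint _ 0 1; set I2 := cint _ 0 1 => e.
    have A0 : A != 0 by rewrite invr_eq0 expf_neq0.
    apply: (mulfI A0); apply/eqP; rewrite -subr_eq0.
    have -> : A * (k * (w + I1) + (k - k0) * I2) - A * ('i%C * (z - kappa) * u 1 * u0 1)
      = (A * k0) * w - (- (A * (k - k0) * w) - A * k * I1 - A * (k - k0) * I2
        + A * ('i%C * (z - kappa) * u 1 * u0 1)) by ring.
    by rewrite Ak0 mul1r e subrr.
  have [_ _ pu pz pp] := sol.
  have bpp := cbmeas_rhs k bBW bu; have bpp0 := cbmeas_rhs k0 bB0 bu0.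
  have g1 := primitiveM bp bpp0 pu pp0; have g2 := primitiveM bpp bp0 pp pu0.
  have := g1 1 i01; have := g2 1 i01; rewrite /= pz p00 !(mulr0, mul0r) !add0r => e2 e1.
  (* The Green identity between the new mode and [u0]. *)
  have e : u 1 * p0 1 - p 1 * u0 1 = 'i%C * (z - kappa) * u 1 * u0 1.
    rewrite e1 e2 -key -!cintZ // -cintD //; try exact: cbmeasZ.
    rewrite -cintB //; try by apply: cbmeasD; apply: cbmeasM.
    by apply: cint_eq => t _; rewrite rmorphD /=; ring.
  apply: (mulIf u01); move: e; rewrite rad0 => e.
  have -> : p 1 * u0 1 = u 1 * (- ('i%C * kappa * u0 1)) - 'i%C * (z - kappa) * u 1 * u0 1.
    by rewrite -e; ring.
  ring.
- apply/eqP => u10; have : N (h 1) = N (u0 1).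
    by rewrite -l1normN -[in RHS](subr0 (u0 1)) -u10 /u opprD addrA subrr add0r.
  have := dh 1 i01; rewrite sub0r l1normN mulr1 -/L => h1 h2.
  move: ru; rewrite -h2; have : 0 < r * L by exact: mulr_gt0.
  lra.
Qed.
End Persistence.

(** * Backward uniqueness and real frequencies *)

Section Uniqueness.
Variable R : realType.
Implicit Types (B : R -> R) (u p f g : R -> R[i]) (k kappa c : R[i]).

Lemma cint_weight_rev f (lam D x : R) : cbmeas f -> 0 < lam -> 0 <= D ->
  (forall t, 0 <= t <= 1 -> N (f t) <= D * expR (- lam * t)) -> 0 <= x <= 1 ->
  N (cint f x 1) <= D / lam * expR (- lam * x).
Proof.
move=> bf lam0 D0 fD /andP[x0 x1].
have be := bmeas_exp (- lam).
apply: le_trans (_ : rint (fun t => D * expR (- lam * t)) x 1 <= _).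
  apply: cint_norm => //; first exact: bmeasZ.
  by move=> t /andP[xt t1]; apply: fD; rewrite t1 (le_trans x0 xt).
rewrite rintZ // rint_exp ?oppr_eq0 ?gt_eqF // invrN mulrN -mulNr opprB.
rewrite -mulrA [_ / lam]mulrC ler_wpM2l // ler_pM2l ?invr_gt0 //.
by rewrite gerBl expR_ge0.
Qed.

(** Iterating the integrated system from the endpoint 1 halves the bound weighted
by [expR (- lam * x)] at each step. *)
Lemma rsol_backward_unique k B u p : rsol k B u p -> u 1 = 0 -> p 1 = 0 ->
  forall x, 0 <= x <= 1 -> u x = 0.
Proof.
move=> sol u1 p1; have bp := rsol_deriv_cbmeas sol.
have [bB bu pu p0 pp] := sol; have bq := cbmeas_rhs k bB bu.
have [M1 M11 uM] := cbmeas_bound bu; have [M2 M21 pM] := cbmeas_bound bp.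
have [M3 BM] := bB.2.
pose K := N k * `|M3|; have K0 : 0 <= K by apply: mulr_ge0 => //; exact: l1norm_ge0.
(* Large enough to halve both the bound for [u] and the one for [p]. *)
pose lam := 2 * (1 + K); have lam0 : 0 < lam by rewrite /lam; lra.
pose D := (M1 + M2) * expR lam.
have D0 : 0 <= D by apply: mulr_ge0; [lra|exact: expR_ge0].
have bnd n : (forall x, 0 <= x <= 1 -> N (u x) <= D / 2 ^+ n * expR (- lam * x)) /\
             (forall x, 0 <= x <= 1 -> N (p x) <= D / 2 ^+ n * expR (- lam * x)).
  elim: n => [|n [IHu IHp]].
    have e1 x : 0 <= x <= 1 -> M1 + M2 <= D / 2 ^+ 0 * expR (- lam * x).
      move=> /andP[x0 x1]; rewrite expr0 divr1 /D -mulrA -expRD.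
      rewrite ler_peMr ?(addr_ge0 (le_trans ler01 M11) (le_trans ler01 M21)) //.
      rewrite -expR0 ler_expR (_ : lam + - lam * x = lam * (1 - x)); last ring.
      by apply: mulr_ge0; [exact: ltW|rewrite subr_ge0].
    split=> x x01; apply: le_trans (e1 x x01).
      by apply: le_trans (uM x x01) _; lra.
    by apply: le_trans (pM x x01) _; lra.
  have Dn : 0 <= D / 2 ^+ n by rewrite divr_ge0 // exprn_ge0.
  have D2 : D / 2 ^+ n.+1 = D / 2 ^+ n / 2 by rewrite exprSr invfM mulrA.
  split=> x /[dup] x01 /andP[x0 x1].
    have -> : u x = - cint p x 1 by rewrite -(primitive_diff bp pu) // u1 sub0r opprK.
    rewrite l1normN; apply: le_trans (cint_weight_rev bp lam0 Dn IHp x01) _.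
    rewrite D2 ler_wpM2r ?expR_ge0 // ler_wpM2l // lef_pV2 ?posrE // /lam; lra.
  have -> : p x = - cint (fun t => - (k * (B t)%:C * u t)) x 1.
    by rewrite -(primitive_diff bq pp) // p1 sub0r opprK.
  have KDn : 0 <= K * (D / 2 ^+ n) by exact: mulr_ge0.
  rewrite l1normN; apply: le_trans (cint_weight_rev bq lam0 KDn _ x01) _.
    move=> t t01; rewrite l1normN -[leRHS]mulrA; apply: l1norm_mul_le (IHu t t01).
    apply: l1norm_mul_le => //; rewrite l1normR; apply: le_trans (BM t t01) _; exact: ler_norm.
  rewrite D2 ler_wpM2r ?expR_ge0 // ler_pdivrMr //.
  have := K0; rewrite /lam; move: (D / 2 ^+ n) Dn KDn => E E0; lra.
move=> x x01; apply/l1norm_eq0/ler_addgt0Pr => e e0; rewrite add0r.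
have [n hn] := half_pow_small (D * expR (- lam * x)) e0.
apply: le_trans hn; rewrite mulrAC; exact: (bnd n).1.
Qed.

Lemma primitive_conj f g : cbmeas g -> primitive f g ->
  primitive (fun x => conjc (f x)) (fun x => conjc (g x)).
Proof.
move=> [rg jg] fg x /[dup] x01 /andP[x0 x1].
apply: complex_ext; rewrite ?ReCD ?ImCD !(ReCJ, ImCJ) fg // ?ReCD ?ImCD /=.
  by congr (_ + _); apply: rint_eq => t _; rewrite /cRe ReCJ.
rewrite opprD; congr (_ + _); rewrite -mulN1r -rintZ //.
by apply: rint_eq => t _; rewrite /cIm ImCJ mulN1r.
Qed.

Lemma primitive_Re f g : primitive f g ->
  primitive (fun x => (Re (f x))%:C) (fun x => (Re (g x))%:C).
Proof.
move=> fg x x01; apply: complex_ext; rewrite ?ReCD ?ImCD /=.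
  by rewrite fg // ReCD.
by rewrite add0r rint0.
Qed.

Lemma primitiveZ c f g : cbmeas g -> primitive f g ->
  primitive (fun x => c * f x) (fun x => c * g x).
Proof.
by move=> bg fg x /[dup] x01 /andP[x0 x1]; rewrite fg // mulrDr cintZ.
Qed.

Lemma primitive_eq f f' g g' : (forall x, 0 <= x <= 1 -> f x = f' x) ->
  (forall x, 0 <= x <= 1 -> g x = g' x) -> primitive f g -> primitive f' g'.
Proof.
move=> ff gg fg x /[dup] x01 /andP[x0 x1].
rewrite -!ff ?lexx ?ler01 // fg //; congr (_ + _); apply: cint_eq => t /andP[t0 tx].
by rewrite gg // t0 (le_trans tx x1).
Qed.

Lemma rsolZ c k B u p : rsol k B u p ->
  rsol k B (fun x => c * u x) (fun x => c * p x).
Proof.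
move=> sol; have bp := rsol_deriv_cbmeas sol.
have [bB bu pu p0 pp] := sol; split => //.
- exact: cbmeasZ.
- exact: primitiveZ.
- by rewrite p0 mulr0.
- apply: primitive_eq (primitiveZ c (cbmeas_rhs k bB bu) pp) => // x _; ring.
Qed.

Lemma rsol_Re (k : R) B u p : rsol k%:C B u p ->
  rsol k%:C B (fun x => (Re (u x))%:C) (fun x => (Re (p x))%:C).
Proof.
move=> [bB bu pu p0 pp]; split => //.
- by apply: cbmeasR; case: bu.
- exact: primitive_Re.
- by rewrite p0.
- apply: primitive_eq (primitive_Re pp) => // x _.
  by apply: complex_ext; rewrite !ReImE ?(mul0r, mulr0, addr0, subr0, oppr0).
Qed.

(** For real [kappa = a] the conjugate mode solves the same equation, so the
Wronskian [u conj(p) - p conj(u)] is constant, and it vanishes at 0; the radiation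
condition makes it [2 i a |u(1)| ^ 2] at 1. *)
Lemma radiating_real_freq (a : R) B u p : a != 0 -> rsol (a%:C ^+ 2) B u p ->
  radiating a%:C u p -> u 1 = 0.
Proof.
move=> a0 sol rad; have bp := rsol_deriv_cbmeas sol.
have [bB bu pu p0 pp] := sol; have bq := cbmeas_rhs (a%:C ^+ 2) bB bu.
have i01 : 0 <= (1 : R) <= 1 by apply/andP; split.
have cu := primitive_conj bp pu; have cp := primitive_conj bq pp.
have g1 := primitiveM bp (cbmeas_conj bq) pu cp; have g2 := primitiveM bq (cbmeas_conj bp) pp cu.
have := g1 1 i01; have := g2 1 i01; rewrite /= p0 conjc0 !(mulr0, mul0r) !add0r => e2 e1.
have e : u 1 * conjc (p 1) = p 1 * conjc (u 1).
  rewrite e1 e2; apply: cint_eq => t _.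
  by apply: complex_ext; rewrite !ReImE /=; ring.
move: e; rewrite rad => /(congr1 (@complex.Im R)); rewrite !ReImE /=.
case: (u 1) => s t /=; rewrite !(mul0r, mulr0, add0r, addr0, subr0, mul1r, sub0r, oppr0).
move=> e; have {e} : a * (s ^+ 2 + t ^+ 2) = 0 by lra.
move/eqP; rewrite mulf_eq0 (negbTE a0) /= => /eqP h.
have s0 : s ^+ 2 = 0 by apply/eqP; rewrite eq_le sqr_ge0 -h lerDl sqr_ge0.
have t0 : t ^+ 2 = 0 by apply/eqP; rewrite eq_le sqr_ge0 -h lerDr sqr_ge0.
by congr (_ +i* _); apply/eqP; rewrite -sqrf_eq0 ?s0 ?t0.
Qed.
End Uniqueness.

(** * The zero frequency *)

Section ZeroFrequency.
Variable R : realType.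
Implicit Types (B f g : R -> R) (u p : R -> R[i]).

(** Twice the hyperbolic functions of [m * x]. *)
Definition ch (m x : R) : R := expR (m * x) + expR (- m * x).
Definition sh (m x : R) : R := expR (m * x) - expR (- m * x).

Lemma primitive_real f g : (forall x, 0 <= x <= 1 -> f x = f 0 + rint g 0 x) ->
  primitive (fun x => (f x)%:C) (fun x => (g x)%:C).
Proof.
move=> fg x x01; apply: complex_ext; rewrite ?ReCD ?ImCD /=; first exact: fg.
by rewrite add0r rint0.
Qed.

Lemma bmeas_ch m : bmeas (ch m).
Proof. by apply: bmeasD; exact: bmeas_exp. Qed.

Lemma bmeas_sh m : bmeas (sh m).
Proof. by apply: bmeasB; exact: bmeas_exp. Qed.

Lemma ch_gt0 m x : 0 < ch m x.
Proof. by rewrite addr_gt0 ?expR_gt0. Qed.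

Lemma ch_primitive m x : m != 0 -> 0 <= x <= 1 -> ch m x = ch m 0 + rint (fun t => m * sh m t) 0 x.
Proof.
move=> m0 /andP[x0 x1].
rewrite rintZ //; last exact: bmeas_sh.
rewrite rintB //; try exact: bmeas_exp.
rewrite !rint_exp ?oppr_eq0 // /ch !mulr0 expR0; by field.
Qed.

Lemma sh_primitive m x : m != 0 -> 0 <= x <= 1 -> sh m x = sh m 0 + rint (fun t => m * ch m t) 0 x.
Proof.
move=> m0 /andP[x0 x1].
rewrite rintZ //; last exact: bmeas_ch.
rewrite rintD //; try exact: bmeas_exp.
rewrite !rint_exp ?oppr_eq0 // /sh !mulr0 expR0; by field.
Qed.

Lemma sqr_imaginary (b : R) : (0 +i* b) ^+ 2 = (- (b ^+ 2))%:C :> R[i].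
Proof. by rewrite expr2; apply: complex_ext => /=; ring. Qed.

Lemma rsol_ch (b s : R) : b * s != 0 ->
  rsol (- (b ^+ 2))%:C (fun=> s ^+ 2) (fun x => (ch (b * s) x)%:C)
    (fun x => (b * s * sh (b * s) x)%:C).
Proof.
set m := b * s => m0; split.
- exact: bmeas_cst.
- by apply: cbmeasR; exact: bmeas_ch.
- by apply: primitive_real => x x01; exact: ch_primitive.
- by rewrite /sh !mulr0 subrr mulr0.
- apply: primitive_eq (primitive_real (f := fun x => m * sh m x) (g := fun x => m * (m * ch m x)) _).
  + by [].
  + by move=> x _; rewrite -!rmorphM -rmorphN /=; congr (_%:C); rewrite /m; ring.
  + move=> x x01; rewrite {1}sh_primitive // mulrDr; congr (_ + _).
    rewrite -rintZ //; last by case/andP: x01.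
    by apply: bmeasZ; exact: bmeas_ch.
Qed.

(** A mode for [i beta] can be rotated to a real solution [f] of
[f'' = beta ^ 2 B f]; then [f f'] and hence [f ^ 2] increase, so [f] keeps its sign.
The Green identity with the larger constant structure [b2] gives
[ch'(1) >= beta * ch(1)] at [m = beta * s], [s ^ 2 = b2], while the opposite holds for
small parameters; the intermediate value theorem provides [b]. *)
Lemma zero_frequency (b1 b2 beta : R) B : 0 <= b1 -> b1 < b2 -> Ad b1 b2 B ->
  quasi_eigs B (0 +i* beta) ->
  exists b s : R, [/\ 0 < b, b <= beta, b2 = s ^+ 2, b * s != 0 &
    radiating (0 +i* b) (fun x => (ch (b * s) x)%:C)
      (fun x => (b * s * sh (b * s) x)%:C)].
Proof.
move=> b10 b12 AdB [k0 [y bvp]].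
have [B' [p [B'b sol [x0 x01 yx0] rad]]] := bvp_rsol (ltW b12) k0 AdB bvp.
have be0 : beta != 0.
  by apply: contra_neq k0 => ->.
rewrite sqr_imaginary in sol.
have i01 : 0 <= (1 : R) <= 1 by apply/andP; split.
have y1 : y 1 != 0.
  apply: contra_neq yx0 => y10; apply: (rsol_backward_unique sol) => //.
  by rewrite rad y10 mulr0 oppr0.
(* The factor [conjc (y 1)] makes the value at 1 positive. *)
pose f x := Re (conjc (y 1) * y x); pose g x := Re (conjc (y 1) * p x).
have solf : rsol (- (beta ^+ 2))%:C B' (fun x => (f x)%:C) (fun x => (g x)%:C).
  exact: rsol_Re (rsolZ _ sol).
have f1 : 0 < f 1.
  rewrite /f ReCM ReCJ ImCJ mulNr opprK -!expr2 lt_neqAle addr_ge0 ?sqr_ge0 // andbT eq_sym.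
  apply: contra_neq y1 => e.
  have s0 : Re (y 1) ^+ 2 = 0 by apply/eqP; rewrite eq_le sqr_ge0 -e lerDl sqr_ge0.
  have t0 : Im (y 1) ^+ 2 = 0 by apply/eqP; rewrite eq_le sqr_ge0 -e lerDr sqr_ge0.
  by apply: complex_ext; apply/eqP; rewrite -sqrf_eq0 ?s0 ?t0.
have g1 : g 1 = beta * f 1.
  rewrite /g /f rad; case: (y 1) => a b /=; ring.
clearbody f g.
have bg := rsol_deriv_cbmeas solf; have [bB bf pf g0 pg] := solf.
have bq := cbmeas_rhs (- (beta ^+ 2))%:C bB bf.
have bf' : bmeas f by case: bf.
have bg' : bmeas g by case: bg.
have gf_ge0 x : 0 <= x <= 1 -> 0 <= g x * f x.
  move=> /[dup] x01' /andP[x0' x1'].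
  have := primitiveM bq bg pg pf x01'; rewrite g0 mul0r add0r.
  move=> /(congr1 (@complex.Re R)); rewrite ReCM !ReCR !ImCR mul0r subr0 => ->.
  apply: rint_ge0 => t /andP[t0 tx]; rewrite /cRe !ReImE.
  have /andP[/(le_trans b10) B0 _] := B'b t.
  have h1 : 0 <= g t ^+ 2 by exact: sqr_ge0.
  have h2 : 0 <= beta ^+ 2 * B' t * f t ^+ 2.
    by apply: mulr_ge0; [apply: mulr_ge0 => //|]; exact: sqr_ge0.
  lra.
have f2_mono a b : 0 <= a -> a <= b -> b <= 1 -> f a ^+ 2 <= f b ^+ 2.
  move=> a0 ab b1'; rewrite -subr_ge0.
  have b2f := cbmeasD (cbmeasM bg bf) (cbmeasM bf bg).
  have := primitive_diff b2f (primitiveM bg bg pf pf) a0 ab b1'.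
  move=> /(congr1 (@complex.Re R)); rewrite !ReImE => e.
  rewrite (_ : f b ^+ 2 - f a ^+ 2 = Re (cint (fun x => (g x)%:C * (f x)%:C + (f x)%:C * (g x)%:C) a b)).
    apply: rint_ge0 => t /andP[t0 tx]; rewrite /cRe !ReImE.
    have : 0 <= g t * f t by apply: gf_ge0; rewrite (le_trans a0 t0) (le_trans tx b1').
    lra.
  apply: etrans e; ring.
have fc : {within `[0, 1], continuous f}.
  have /= c1 : {within `[0, 1], continuous (fun x => rint g 0 x)}.
    exact: (parameterized_integral_continuous ler01 (bmeas_integrable bg' (lexx 0) (lexx 1))).
  have fE x : 0 <= x <= 1 -> f x = f 0 + rint g 0 x.
    by move=> /pf /(congr1 (@complex.Re R)); rewrite ReCD /=.
  apply: (@subspace_eq_continuous _ _ _ (fun x => f 0 + rint g 0 x)).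
    by move=> x; rewrite inE /= in_itv /= => x01'; rewrite /from_subspace -fE.
  by move=> x; apply: cvgD; [exact: cvg_cst|exact: c1].
have f_ge0 x : 0 <= x <= 1 -> 0 <= f x.
  move=> /andP[x0' x1']; rewrite leNgt; apply/negP => fx0.
  have cx : {within `[x, 1], continuous f}.
    by apply: continuous_subspaceW fc; exact: subitv01.
  have [|c /[!in_itv] /= /andP[xc c1] fc0] := IVT x1' cx (v := 0).
    by rewrite ge_min le_max (ltW fx0) (ltW f1) orbT.
  have := f2_mono x c x0' xc c1; rewrite fc0 expr0n /= => h.
  have : 0 < f x ^+ 2 by rewrite exprn_even_gt0 //= lt_eqF.
  lra.
have beta0 : 0 < beta.
  rewrite lt_neqAle eq_sym be0 /= -(pmulr_rge0 _ (mulr_gt0 f1 f1)).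
  have := gf_ge0 1 i01; rewrite g1; lra.
have b20 : 0 < b2 by exact: le_lt_trans b12.
pose s := Num.sqrt b2; have s0 : 0 < s by rewrite sqrtr_gt0.
have ss : b2 = s ^+ 2 by rewrite sqr_sqrtr // ltW.
pose m := beta * s; have m0 : 0 < m by exact: mulr_gt0.
have solc := rsol_ch (lt0r_neq0 m0); rewrite -/m in solc.
have bc' := rsol_deriv_cbmeas solc; have [bBc bc pc c0 pc'] := solc.
have bqc := cbmeas_rhs (- (beta ^+ 2))%:C bBc bc.
have green : g 1 * ch m 1 <= f 1 * (m * sh m 1).
  have h1 := primitiveM bg bqc pf pc' i01; have h2 := primitiveM bq bc' pg pc i01.
  rewrite g0 c0 mulr0 mul0r !add0r in h1 h2.
  have : (f 1)%:C * (m * sh m 1)%:C - (g 1)%:C * (ch m 1)%:C =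
     cint (fun t => (beta ^+ 2 * (b2 - B' t) * f t * ch m t)%:C) 0 1.
    rewrite h1 h2 -cintB //; try by apply: cbmeasD; apply: cbmeasM.
    apply: cint_eq => t _; rewrite ss.
    by apply: complex_ext; rewrite !ReImE; ring.
  move=> /(congr1 (@complex.Re R)); rewrite !ReImE /= => e.
  rewrite -subr_ge0 (_ : _ - _ = rint (cRe (fun t => (beta ^+ 2 * (b2 - B' t) * f t * ch m t)%:C)) 0 1).
    apply: rint_ge0 => t t01; rewrite /cRe ReCR.
    have /andP[_ Bb] := B'b t.
    apply: mulr_ge0; last exact: ltW (ch_gt0 _ _).
    apply: mulr_ge0; last exact: f_ge0.
    by apply: mulr_ge0; [exact: sqr_ge0|rewrite subr_ge0].
  apply: etrans e; ring.
(* [b * phi b] is the defect of the radiation condition of the mode [ch (b * s)]. *)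
pose phi b := s * sh (b * s) 1 - ch (b * s) 1.
have phib : 0 <= phi beta.
  have : 0 <= beta * f 1 * phi beta.
    move: green; rewrite g1 /phi -/m {2}/m; lra.
  by rewrite pmulr_rge0 // mulr_gt0.
have phi0 : phi 0 <= 0.
  by rewrite /phi /sh /ch mul0r oppr0 mul0r expR0 subrr mulr0; lra.
have phic : {within `[0, beta], continuous phi}.
  apply: continuous_subspaceT => t.
  have ce (a : R) : {for t, continuous (fun b : R => expR (a * b))} by exact: continuous_expM.
  rewrite (_ : phi = fun b => s * (expR (s * b) - expR (- s * b)) - (expR (s * b) + expR (- s * b))).
    apply: cvgB; last by apply: cvgD; exact: ce.
    by apply: cvgMr; apply: cvgB; exact: ce.
  by apply/funext => b; rewrite /phi /sh /ch !mulr1 -mulNr ![_ * s]mulrC mulrN mulNr.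
have [|b /[!in_itv] /= /andP[b0 bb] phib0] := IVT (ltW beta0) phic (v := 0).
  by rewrite ge_min le_max phi0 phib orbT.
have b0' : 0 < b.
  rewrite lt_neqAle b0 andbT; apply: contra_eq_neq phib0 => <-.
  by rewrite /phi /sh /ch mul0r oppr0 mul0r expR0 subrr mulr0 lt_eqF //; lra.
exists b, s; split => //; first by rewrite mulf_neq0 ?gt_eqF.
rewrite /radiating; apply: complex_ext; rewrite !ReImE /= ?(mul0r, mulr0, subr0, add0r, oppr0) //.
have : b * phi b = 0 by rewrite phib0 mulr0.
rewrite /phi; lra.
Qed.
End ZeroFrequency.

(** * Zero sets of solutions *)

Section ZeroSets.
Variable R : realType.
Implicit Types (B f g : R -> R) (u p : R -> R[i]).

(** If the derivative at [x] is not 0, then [F] avoids the value [F x] near [x]. *)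
Lemma zero_deriv_isolated (F : R -> R) (A : set R) x (c : R) :
  derivable F x 1 -> derive1 F x = c -> c != 0 -> A x ->
  (forall t, A t -> F t = F x) -> isolated A x.
Proof.
move=> dF Fc c0 Ax FA; split; first exact/mem_set.
have : h^-1 *: (F (h + x) - F x) @[h --> 0^'] --> c.
  rewrite -Fc derive1E; move: dF => /cvg_ex[l hl].
  rewrite (_ : 'D_1 F x = l); last exact/cvg_lim.
  by move: hl; under eq_fun do rewrite [_ *: 1]mulr1.
move=> /cvgr_neq0 /(_ c0) near0.
exists [set t | t != x -> F t != F x]; last first.
  apply/seteqP; split => t /=.
    move=> [h At]; apply/eqP; apply: contraT => tx.
    by have := h tx; rewrite FA // eqxx.
  by move=> ->; rewrite eqxx.
suff : \forall t \near (x : R), t != x -> F t != F x by [].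
apply/(@nbhs0P R R).
have near0' : \forall h \near (0 : R), h != 0 -> h^-1 *: (F (h + x) - F x) != 0 := near0.
apply: filterS near0' => h hx /=; rewrite -subr_eq0 addrAC subrr add0r => /hx.
by rewrite [x + h]addrC; apply: contra_neq => ->; rewrite subrr scaler0.
Qed.

(** By Lebesgue differentiation almost every zero of [f] where [g] does not vanish
is an isolated zero, and isolated points are countably many. *)
Lemma deriv_zero_set f g : bmeas g ->
  (forall x, 0 <= x <= 1 -> f x = f 0 + rint g 0 x) ->
  {ae leb R, forall x, 0 < x < 1 -> f x = 0 -> g x = 0}.
Proof.
move=> bg fg.
pose G := g \_ (`[0, 1] : set R).
have [mg [M gM]] := bg.
have iG : (leb R).-integrable setT (EFin \o G).
  rewrite /G -restrict_EFin; apply/integrable_restrict => //=.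
  by rewrite setTI; exact: bmeas_integrable.
pose F x := rint G 0 x.
have FE x : 0 <= x <= 1 -> f x = f 0 + F x.
  move=> /[dup] x01 /andP[x0 x1]; rewrite fg //; congr (_ + _); apply: rint_eq => t /andP[t0 tx].
  by rewrite /G patchE mem_set //= in_itv /= t0 (le_trans tx x1).
have dF : {ae leb R, forall x, 0 < x -> derivable F x 1 /\ derive1 F x = G x}.
  have iGy (y : R) : (leb R).-integrable [set` Interval (BLeft 0) (BRight y)] (EFin \o G).
    by apply: integrableS iG.
  have := FTC1 iGy (open_integrable_locally openT iG).
  by apply: ae_imp => x h x0; apply: h; rewrite /= lte_fin.
pose A : set R := [set x | 0 < x < 1 /\ f x = 0].
have nI : {ae leb R, forall x, ~ isolated A x}.
  have cI := countable_isolated A.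
  exists (isolated A); split.
  - exact: countable_measurable.
  - exact: countable_lebesgue_measure0.
  - by move=> x /= /contrapT.
apply: ae_imp2 dF nI => x dFx nIx x01 fx.
have /andP[x0 x1] := x01; have [d1 d2] := dFx x0.
have Gx : G x = g x by rewrite /G patchE mem_set //= in_itv /= !ltW.
apply/eqP; apply: contraT => gx; exfalso; apply: nIx.
apply: (zero_deriv_isolated d1 d2); rewrite ?Gx //.
have i01 (t : R) : 0 < t < 1 -> 0 <= t <= 1 by move=> /andP[t0 t1]; rewrite !ltW.
move=> t [t01 ft]; have ex := FE x (i01 x x01); have et := FE t (i01 t t01).
by apply: (@addrI _ (f 0)); rewrite -ex -et fx ft.
Qed.

(** Where [Im u = 0], also [Im u'' = 0] almost everywhere; but [Im u'' = - Im k * B * Re u]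
there. *)
Lemma rsol_real_points (k : R[i]) B u p : Im k != 0 -> rsol k B u p ->
  {ae leb R, forall x, 0 < x < 1 -> Im (u x) = 0 -> (B x)%:C * u x = 0}.
Proof.
move=> k0 sol; have bp := rsol_deriv_cbmeas sol.
have [bB bu pu _ pp] := sol; have bq := cbmeas_rhs k bB bu.
have partIm (v w : R -> R[i]) : primitive v w ->
    forall x, 0 <= x <= 1 -> cIm v x = cIm v 0 + rint (cIm w) 0 x.
  by move=> vw x x01; rewrite /cIm vw // ImCD.
have z1 := deriv_zero_set bp.2 (partIm _ _ pu).
have z2 := deriv_zero_set bq.2 (partIm _ _ pp).
apply: ae_imp2 z1 z2 => x h1 h2 x01 ux; have := h2 x01 (h1 x01 ux).
rewrite /cIm ImCN !(ImCM, ReCM) ux ImCR ReCR !(mulr0, addr0, add0r) => /eqP.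
rewrite oppr_eq0 !mulf_eq0 (negbTE k0) /= => /orP[/eqP->|/eqP r0]; first by rewrite mul0r.
by rewrite (_ : u x = 0) ?mulr0 //; apply: complex_ext.
Qed.

(** [Im (u ^ 2) = 0] means that [u] or [i u] is real. *)
Lemma rsol_real_square (k : R[i]) B u p : Im k != 0 -> rsol k B u p ->
  {ae leb R, forall x, 0 < x < 1 -> Im (u x ^+ 2) = 0 -> (B x)%:C * u x = 0}.
Proof.
move=> k0 sol.
have z1 := rsol_real_points k0 sol.
have z2 := rsol_real_points k0 (rsolZ (0 +i* 1) sol).
apply: ae_imp2 z1 z2 => x h1 h2 x01; rewrite expr2 ImCM mulrC -mulr2n => /eqP.
rewrite mulrn_eq0 /= mulf_eq0 => /orP[/eqP e|/eqP e]; first exact: h1.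
have i0 : (0 +i* 1 : R[i]) != 0 by rewrite eq_complex /= oner_eq0 andbF.
apply: (mulfI i0); rewrite mulr0 mulrCA; apply: h2 => //.
by rewrite ImCM /= mul0r mul1r add0r.
Qed.

Lemma rint_eq0 f : bmeas f -> (forall x, 0 <= x <= 1 -> 0 <= f x) -> rint f 0 1 <= 0 ->
  {ae leb R, forall x, 0 < x < 1 -> f x = 0}.
Proof.
move=> bf f0 If; have bi := bmeas_integrable bf (lexx 0) (lexx 1).
have If0 : (\int[leb R]_(x in `[0%R, 1%R]) `|(f x)%:E| = 0)%E.
  transitivity (\int[leb R]_(x in `[0%R, 1%R]) (f x)%:E)%E.
    apply: eq_integral => x; rewrite inE /= in_itv /= => x01.
    by rewrite ger0_norm ?f0.
  rewrite -[LHS]fineK ?(integrable_fin_num _ bi) //.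
  congr (_%:E); apply/eqP; rewrite eq_le If /=; exact: rint_ge0.
have := (ae_eq_integral_abs (leb R) (measurable_itv `[0, 1]) (measurable_int _ bi)).1 If0.
apply: ae_imp => x h /andP[x0 x1].
have := h _; rewrite /= in_itv /= !ltW // => /(_ isT); by case.
Qed.
End ZeroSets.

(** * Convex cones in the plane *)

Section Cones.
Variable R : realType.

(** If the cone misses the positive horizontal axis, the ratio [x / y] of a point
above the axis is at most that of every point below it; the supremum [sup S] of
the former ratios gives the bounding line [x = sup S * y]. *)
Lemma plane_cone_halfplane (K : R -> R -> Prop) :
  (forall x y x' y', K x y -> K x' y' -> K (x + x') (y + y')) ->
  (forall t x y, 0 < t -> K x y -> K (t * x) (t * y)) ->
  ~ K 1 0 ->
  exists a b : R, (a != 0) || (b != 0) /\ forall x y, K x y -> a * x + b * y <= 0.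
Proof.
move=> Kadd Kscale K10.
have [up|/existsNP[x1 /existsNP[y1 /not_implyP[K1 /negP]]]] := pselect (forall x y, K x y -> y <= 0).
  by exists 0, 1; split; [rewrite oner_eq0 orbT|move=> x y /up; rewrite mul0r mul1r add0r].
rewrite -ltNge => y10.
have [dn|/existsNP[x2 /existsNP[y2 /not_implyP[K2 /negP]]]] := pselect (forall x y, K x y -> 0 <= y).
  exists 0, (-1); split; first by rewrite oppr_eq0 oner_eq0 orbT.
  by move=> x y /dn; rewrite mul0r mulN1r add0r oppr_le0.
rewrite -ltNge => y20.
have key x y x' y' : K x y -> 0 < y -> K x' y' -> y' < 0 -> x / y <= x' / y'.
  move=> Kxy y0 Kxy' y'0; rewrite leNgt; apply/negP => lt.
  have iy : 0 < y^-1 by rewrite invr_gt0.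
  have iy' : 0 < - y'^-1 by rewrite oppr_gt0 invr_lt0.
  have := Kadd _ _ _ _ (Kscale _ _ _ iy Kxy) (Kscale _ _ _ iy' Kxy').
  rewrite !mulNr [y^-1 * x]mulrC [y'^-1 * x']mulrC.
  rewrite [y^-1 * y]mulVf ?gt_eqF // [y'^-1 * y']mulVf ?lt_eqF // subrr => h.
  have d0 : 0 < (x / y - x' / y')^-1 by rewrite invr_gt0 subr_gt0.
  have := Kscale _ _ _ d0 h; rewrite mulr0 mulVf //.
  by rewrite gt_eqF // subr_gt0.
pose S : set R := [set s | exists x y, [/\ K x y, 0 < y & s = x / y]].
have S0 : S !=set0 by exists (x1 / y1), x1, y1.
have Sub : has_ubound S.
  by exists (x2 / y2) => _ [x [y [Kxy y0 ->]]]; exact: key.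
exists 1, (- sup S); split; first by rewrite oner_eq0.
move=> x y Kxy; rewrite mul1r mulNr subr_le0.
case: (ltgtP y 0) => y0.
- rewrite -ler_ndivlMr //; apply: ge_sup => // _ [x' [y' [Kxy' y'0 ->]]].
  exact: key.
- by rewrite -ler_pdivrMr //; apply: ub_le_sup => //; exists x, y.
- rewrite y0 mulr0 leNgt; apply/negP => x0; apply: K10.
  have ix : 0 < x^-1 by rewrite invr_gt0.
  by have := Kscale _ _ _ ix Kxy; rewrite y0 mulr0 mulVf // gt_eqF.
Qed.

Lemma complex_cone_halfplane (K : R[i] -> Prop) w :
  (forall z z', K z -> K z' -> K (z + z')) ->
  (forall (t : R) z, 0 < t -> K z -> K (t%:C * z)) ->
  w != 0 -> ~ K w ->
  exists2 c : R[i], c != 0 & forall z, K z -> Re (c * z) <= 0.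
Proof.
move=> Kadd Kscale w0 Kw.
have [||/=|a [b [ab h]]] := @plane_cone_halfplane (fun x y => K (w * (x +i* y))).
- by move=> x y x' y' h h'; have := Kadd _ _ h h'; rewrite -mulrDr.
- move=> t x y t0 h; have := Kscale _ _ t0 h; rewrite mulrCA.
  by congr (K (_ * _)); apply: complex_ext => /=; ring.
- by rewrite (_ : 1 +i* 0 = 1) // mulr1.
exists ((a -i* b) / w).
  rewrite mulf_neq0 ?invr_eq0 // eq_complex /= oppr_eq0 negb_and.
  exact: ab.
move=> z Kz; have e : z = w * (w^-1 * z) by rewrite mulrA divff // mul1r.
have := h (Re (w^-1 * z)) (Im (w^-1 * z)).
rewrite -mulrA; set v := w^-1 * z in e *; case: v e => x y /= e h'.
have := h'; rewrite -e => /(_ Kz); lra.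
Qed.
End Cones.

(** * First variation and optimality *)

Section Optimality.
Variable R : realType.
Variables (b1 b2 : R).
Implicit Types (B : R -> R) (u p : R -> R[i]).

(** Structures normalised to satisfy the bounds everywhere. *)
Definition adm B : Prop := bmeas B /\ forall x, b1 <= B x <= b2.

Lemma adm_Ad B : adm B -> Ad b1 b2 B.
Proof.
by move=> [bB Bb]; split; [exact: bmeas_Linf01|apply: nearW => x _; exact: Bb].
Qed.

Lemma optimal_qeP (alpha : R) kappa : optimal_qe b1 b2 alpha kappa ->
  exists beta, [/\ calI b1 b2 alpha = beta%:E, kappa = alpha +i* beta,
    quasi_eigs_Ad b1 b2 kappa &
    forall z, quasi_eigs_Ad b1 b2 z -> Re z = alpha -> beta <= Im z].
Proof.
move=> [beta [Ib ->]]; exists beta; move: (Ib); rewrite /calI.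
case: xgetP => [y _ [m [[k [rk qk] imk] lbm]] <-|_] //.
case=> mb; subst m; split; first by rewrite mb.
- by [].
- by rewrite -mb -rk; case: (k) qk.
- by move=> z qz rz; rewrite -mb; apply: lbm; exists z.
Qed.

Hypothesis b10 : 0 <= b1.
Hypothesis b12 : b1 < b2.

Lemma bmeas_adm B : (forall x, b1 <= B x <= b2) ->
  measurable_fun (`[0, 1] : set R) B -> adm B.
Proof.
move=> Bb mB; split => //; split => //; exists b2 => x _.
by have /andP[h1 h2] := Bb x; rewrite ger0_norm // (le_trans b10).
Qed.

Lemma bang_bang_adm u : cbmeas u -> adm (bang_bang b1 b2 u).
Proof.
move=> bu; apply: bmeas_adm.
  move=> x; rewrite /bang_bang /chiCplus; have l := ltW b12.
  by case: ifP => _; apply/andP; split; lra.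
have [[_ _] [mI _]] := cbmeasM bu bu.
apply: measurable_funD; first exact: measurable_cst.
apply: measurable_funM; first exact: measurable_cst.
apply: measurable_fun_if => //; try exact: measurable_cst.
by apply: measurable_fun_ltr => //; exact: measurable_cst.
Qed.

Section Perturbation.
Variables (kappa : R[i]) (B0 : R -> R) (u0 p0 : R -> R[i]).
Hypothesis kappa0 : kappa != 0.
Hypothesis admB0 : adm B0.
Hypothesis sol0 : rsol (kappa ^+ 2) B0 u0 p0.
Hypothesis rad0 : radiating kappa u0 p0.
Hypothesis u01 : u0 1 != 0.

Definition first_variation B : R[i] :=
  cint (fun t => (B t - B0 t)%:C * u0 t ^+ 2) 0 1.

Definition variation_cone (z : R[i]) : Prop :=
  exists (t : R) B, [/\ 0 < t, adm B & z = t%:C * first_variation B].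

Let bu0 : cbmeas u0. Proof. by case: sol0. Qed.

Let bvar B : bmeas B -> cbmeas (fun t => (B t - B0 t)%:C * u0 t ^+ 2).
Proof.
by move=> bB; apply: cbmeasM; [apply: cbmeasR; exact: bmeasB bB admB0.1|exact: cbmeasM].
Qed.

Lemma variation_coneD z z' : variation_cone z -> variation_cone z' ->
  variation_cone (z + z').
Proof.
move=> [t [B [t0 aB ->]]] [t' [B' [t'0 aB' ->]]].
pose s := t + t'; have s0 : 0 < s by exact: addr_gt0.
have s0' : s != 0 by rewrite gt_eqF.
exists s, (fun x => t / s * B x + t' / s * B' x); split => //.
- split.
    apply: bmeasD; apply: bmeasZ; [exact: aB.1|exact: aB'.1].
  move=> x; have /andP[h1 h2] := aB.2 x; have /andP[h3 h4] := aB'.2 x.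
  have e : t / s + t' / s = 1 by rewrite -mulrDl divff.
  have q : 0 <= t / s by rewrite divr_ge0 ?ltW.
  have q' : 0 <= t' / s by rewrite divr_ge0 ?ltW.
  have i1 := ler_wpM2l q h1; have i2 := ler_wpM2l q h2.
  have i3 := ler_wpM2l q' h3; have i4 := ler_wpM2l q' h4.
  have e1 : t / s * b1 + t' / s * b1 = b1 by rewrite -mulrDl e mul1r.
  have e2 : t / s * b2 + t' / s * b2 = b2 by rewrite -mulrDl e mul1r.
  by apply/andP; split; lra.
- have c1 := bvar aB.1; have c2 := bvar aB'.1.
  rewrite /first_variation -!cintZ //; last first.
    apply: bvar; apply: bmeasD; apply: bmeasZ; [exact: aB.1|exact: aB'.1].
  rewrite -cintD //; try exact: cbmeasZ.
  apply: cint_eq => x _.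
  have e : s * (t / s * B x + t' / s * B' x - B0 x) = t * (B x - B0 x) + t' * (B' x - B0 x).
    by rewrite /s; field.
  by rewrite ![_%:C * (_%:C * _)]mulrA -!rmorphM /= e rmorphD mulrDl.
Qed.

Lemma variation_coneZ (t : R) z : 0 < t -> variation_cone z -> variation_cone (t%:C * z).
Proof.
move=> t0 [s [B [s0 aB ->]]]; exists (t * s), B; split => //; first exact: mulr_gt0.
by rewrite mulrA -rmorphM.
Qed.

(** Positive part: a real coefficient [a] is realised by moving with weight [pos a]
in one direction and [pos (- a)] in another, since directions of a convex set
cannot be reversed. *)
Definition pos (a : R) : R := Num.max a 0.

Lemma pos_ge0 a : 0 <= pos a. Proof. by rewrite le_max lexx orbT. Qed.

Lemma pos_diff a : pos a - pos (- a) = a.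
Proof. by rewrite /pos; case: (ltP a 0); case: (ltP (- a) 0); lra. Qed.

Lemma pos0 : pos 0 = 0. Proof. by rewrite /pos maxxx. Qed.

Lemma pos_le_norm a : pos a <= `|a|.
Proof. by rewrite ge_max ler_norm normr_ge0. Qed.

Lemma pos_lip a b : `|pos a - pos b| <= `|a - b|.
Proof.
have h1 := ler_norm (a - b); have h2 := ler_norm (- (a - b)); rewrite normrN in h2.
have h3 := normr_ge0 (a - b).
by rewrite ler_norml /pos; case: (ltP a 0); case: (ltP b 0) => *; apply/andP; split; lra.
Qed.

(** The four directions realising [1], [-1], [i], [-i] give a family [W w] with first
variation [w], piecewise linear in [w]; [B0 + W w] is a convex combination of
admissible structures for small [w]. *)
Lemma full_cone_perturbation :
  variation_cone 1 -> variation_cone (-1) ->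
  variation_cone (0 +i* 1) -> variation_cone (- (0 +i* 1)) ->
  exists2 delta, 0 < delta & forall z, N (z - kappa) <= delta -> z != 0 ->
    quasi_eigs_Ad b1 b2 z.
Proof.
move=> [t1 [B1 [t10 aB1 e1]]] [t2 [B2 [t20 aB2 e2]]].
move=> [t3 [B3 [t30 aB3 e3]]] [t4 [B4 [t40 aB4 e4]]].
pose V t B (x : R) : R := t * (B x - B0 x).
pose W (w : R[i]) (x : R) : R := pos (Re w) * V t1 B1 x + pos (- Re w) * V t2 B2 x
  + (pos (Im w) * V t3 B3 x + pos (- Im w) * V t4 B4 x).
pose C := (b2 - b1) * (t1 + t2 + t3 + t4).
have bV t B : adm B -> bmeas (V t B).
  by move=> aB; apply: bmeasZ; exact: bmeasB aB.1 admB0.1.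
have Vb t B x : 0 < t -> adm B -> `|V t B x| <= (b2 - b1) * t.
  move=> t0 aB; rewrite /V normrM gtr0_norm // mulrC ler_pM2r //.
  have /andP[h1 h2] := aB.2 x; have /andP[h3 h4] := admB0.2 x.
  by rewrite ler_norml; apply/andP; split; lra.
have bW w : bmeas (W w).
  by apply: bmeasD; apply: bmeasD; apply: bmeasZ; exact: bV.
have W0 x : W 0 x = 0 by rewrite /W /= oppr0 pos0 !mul0r !addr0.
have b12' := b12.
have C0 : 0 <= C by apply: mulr_ge0; lra.
have lipW w w' x : 0 <= x <= 1 -> `|W w x - W w' x| <= C * N (w - w').
  move=> _.
  have pr a b v M : `|a - b| <= N (w - w') -> `|v| <= M ->
      `|pos a * v - pos b * v| <= M * N (w - w').
    move=> ab vM; rewrite -mulrBl normrM mulrC; apply: ler_pM => //.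
    exact: le_trans (pos_lip _ _) ab.
  have rw : `|Re w - Re w'| <= N (w - w') by rewrite -ReCN -ReCD Re_le_l1norm.
  have iw : `|Im w - Im w'| <= N (w - w') by rewrite -ImCN -ImCD Im_le_l1norm.
  have rw' : `|- Re w - - Re w'| <= N (w - w') by rewrite -opprD normrN.
  have iw' : `|- Im w - - Im w'| <= N (w - w') by rewrite -opprD normrN.
  have q1 := pr _ _ _ _ rw (Vb _ _ x t10 aB1); have q2 := pr _ _ _ _ rw' (Vb _ _ x t20 aB2).
  have q3 := pr _ _ _ _ iw (Vb _ _ x t30 aB3); have q4 := pr _ _ _ _ iw' (Vb _ _ x t40 aB4).
  have -> : W w x - W w' x = (pos (Re w) * V t1 B1 x - pos (Re w') * V t1 B1 x)
    + (pos (- Re w) * V t2 B2 x - pos (- Re w') * V t2 B2 x)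
    + ((pos (Im w) * V t3 B3 x - pos (Im w') * V t3 B3 x)
    + (pos (- Im w) * V t4 B4 x - pos (- Im w') * V t4 B4 x)) by rewrite /W; ring.
  apply: le_trans (ler_normD _ _) _.
  apply: le_trans (lerD (ler_normD _ _) (ler_normD _ _)) _.
  apply: le_trans (lerD (lerD q1 q2) (lerD q3 q4)) _.
  rewrite /C; lra.
have intV t B (a : R) : adm B -> cint (fun x => (a * V t B x)%:C * u0 x ^+ 2) 0 1
    = a%:C * (t%:C * first_variation B).
  move=> aB; have c1 := bvar aB.1.
  rewrite /first_variation mulrA -cintZ //; apply: cint_eq => x _.
  by rewrite /V !rmorphM /=; ring.
have intW w : cint (fun t => (W w t)%:C * u0 t ^+ 2) 0 1 = w.
  have cV t B (a : R) : adm B -> cbmeas (fun x => (a * V t B x)%:C * u0 x ^+ 2).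
    by move=> aB; apply: cbmeasM; [apply: cbmeasR; apply: bmeasZ; exact: bV|exact: cbmeasM].
  transitivity (cint (fun x => ((pos (Re w) * V t1 B1 x)%:C * u0 x ^+ 2
      + (pos (- Re w) * V t2 B2 x)%:C * u0 x ^+ 2)
     + ((pos (Im w) * V t3 B3 x)%:C * u0 x ^+ 2
      + (pos (- Im w) * V t4 B4 x)%:C * u0 x ^+ 2)) 0 1).
    by apply: cint_eq => x _; rewrite /W !rmorphD /= !mulrDl.
  rewrite !cintD //; try (by apply: cbmeasD; exact: cV); try exact: cV.
  rewrite !intV // -e1 -e2 -e3 -e4 mulr1 !mulrN mulr1 -mulrBl -!rmorphB /= !pos_diff.
  by case: w => a b; apply: complex_ext => /=; ring.
pose r := (t1 + t2 + t3 + t4)^-1.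
have s0 : 0 < t1 + t2 + t3 + t4 by lra.
have r0 : 0 < r by rewrite invr_gt0.
have admW w : N w <= r -> adm (fun x => B0 x + W w x).
  move=> wr; split; first exact: bmeasD admB0.1 (bW w).
  move=> x.
  have pw (a t : R) : `|a| <= N w -> 0 < t -> pos a * t <= r * t.
    move=> an t0; rewrite ler_pM2r //; apply: le_trans (pos_le_norm _) _.
    exact: le_trans an wr.
  have sr : r * t1 + r * t2 + r * t3 + r * t4 = 1.
    by rewrite -!mulrDr mulVf // gt_eqF.
  have Nw : N w = `|Re w| + `|Im w| by [].
  have nr := normr_ge0 (Re w); have ni := normr_ge0 (Im w).
  have sum1 : pos (Re w) * t1 + pos (- Re w) * t2 + pos (Im w) * t3 + pos (- Im w) * t4 <= 1.
    have m1 := pw (Re w) t1 (Re_le_l1norm _) t10.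
    have m3 := pw (Im w) t3 (Im_le_l1norm _) t30.
    have m2 : pos (- Re w) * t2 <= r * t2 by apply: pw; rewrite ?normrN ?Re_le_l1norm.
    have m4 : pos (- Im w) * t4 <= r * t4 by apply: pw; rewrite ?normrN ?Im_le_l1norm.
    lra.
  have conv (c1 c2 c3 c4 v0 v1 v2 v3 v4 : R) : 0 <= c1 -> 0 <= c2 -> 0 <= c3 -> 0 <= c4 ->
     c1 + c2 + c3 + c4 <= 1 -> 0 <= v0 -> 0 <= v1 -> 0 <= v2 -> 0 <= v3 -> 0 <= v4 ->
     0 <= v0 + (c1 * (v1 - v0) + c2 * (v2 - v0) + (c3 * (v3 - v0) + c4 * (v4 - v0))).
    move=> g1 g2 g3 g4 gs k0 k1 k2 k3 k4.
    have l0 : 0 <= (1 - (c1 + c2 + c3 + c4)) * v0 by apply: mulr_ge0; rewrite ?subr_ge0.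
    have l1 := mulr_ge0 g1 k1; have l2 := mulr_ge0 g2 k2.
    have l3 := mulr_ge0 g3 k3; have l4 := mulr_ge0 g4 k4.
    lra.
  have p1 : 0 <= pos (Re w) * t1 by apply: mulr_ge0; [exact: pos_ge0|exact: ltW].
  have p2 : 0 <= pos (- Re w) * t2 by apply: mulr_ge0; [exact: pos_ge0|exact: ltW].
  have p3 : 0 <= pos (Im w) * t3 by apply: mulr_ge0; [exact: pos_ge0|exact: ltW].
  have p4 : 0 <= pos (- Im w) * t4 by apply: mulr_ge0; [exact: pos_ge0|exact: ltW].
  have /andP[h0 h0'] := admB0.2 x; have /andP[h1 h1'] := aB1.2 x.
  have /andP[h2 h2'] := aB2.2 x; have /andP[h3 h3'] := aB3.2 x.
  have /andP[h4 h4'] := aB4.2 x.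
  apply/andP; split.
    have := conv _ _ _ _ (B0 x - b1) (B1 x - b1) (B2 x - b1) (B3 x - b1) (B4 x - b1)
      p1 p2 p3 p4 sum1; rewrite !subr_ge0 => /(_ h0 h1 h2 h3 h4).
    move=> g; rewrite -subr_ge0; apply: le_trans g _; apply: le_of_eq; rewrite /W /V; ring.
  have := conv _ _ _ _ (b2 - B0 x) (b2 - B1 x) (b2 - B2 x) (b2 - B3 x) (b2 - B4 x)
      p1 p2 p3 p4 sum1; rewrite !subr_ge0 => /(_ h0' h1' h2' h3' h4').
  move=> g; rewrite -subr_ge0; apply: le_trans g _; apply: le_of_eq; rewrite /W /V; ring.
have [delta d0 hd] := persistence kappa0 sol0 rad0 u01 C0 W0 bW lipW intW r0.
exists delta => // z zd z0; have [w [u [p [wr sol rad u1]]]] := hd z zd.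
exists (fun x => B0 x + W w x); first exact/adm_Ad/admW.
split => //; exists u; apply: rsol_bvp sol _ rad _ => //.
  by exists 1 => //; apply/andP; split.
exact: nearW.
Qed.

(** The bang-bang structure [B1] of [y] maximises [int B Im (y ^ 2)] pointwise, and
its first variation lies in the half-plane; hence the nonnegative integrand
[(B1 - B0) Im (y ^ 2)] vanishes almost everywhere. What remains is the set where
[y ^ 2] is real. *)
Lemma halfplane_bang_bang c d : c != 0 -> Im (kappa ^+ 2) != 0 ->
  (forall z, variation_cone z -> Re (c * z) <= 0) ->
  d ^+ 2 = (0 +i* 1) * c ->
  let y := fun x => d * u0 x in
  {ae leb R, forall x, 0 < x < 1 -> (B0 x)%:C * y x = (bang_bang b1 b2 y x)%:C * y x}.
Proof.
move=> c0 Imk cone dc y.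
have soly : rsol (kappa ^+ 2) B0 y (fun x => d * p0 x) := rsolZ d sol0.
have by_ : cbmeas y by case: soly.
have aB := bang_bang_adm by_.
pose B1 := bang_bang b1 b2 y; rewrite -/B1 in aB *.
have ImY x : Im (y x ^+ 2) = Re (c * u0 x ^+ 2).
  by rewrite /y exprMn dc -mulrA ImCM /= mul0r mul1r add0r.
pose h x := Re (c * ((B1 x - B0 x)%:C * u0 x ^+ 2)).
have hE x : h x = (B1 x - B0 x) * Im (y x ^+ 2).
  by rewrite ImY /h mulrCA [LHS]ReCM ImCR mul0r subr0.
have bh : bmeas h by have [] := cbmeasZ c (bvar aB.1).
have h_ge0 x : 0 <= h x.
  rewrite hE /B1 /bang_bang /chiCplus; have /andP[l1 l2] := admB0.2 x.
  case: ltP => yx.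
    by apply: mulr_ge0; [lra|exact: ltW].
  by rewrite mulr0 addr0; apply: mulr_le0 => //; rewrite subr_le0.
have hI : rint h 0 1 <= 0.
  have : variation_cone (first_variation B1).
    by exists 1, B1; split => //; rewrite mul1r.
  move=> /cone; rewrite /first_variation -cintZ //; exact: bvar aB.1.
have z1 := rint_eq0 bh (fun x _ => h_ge0 x) hI.
have z2 := rsol_real_square Imk soly.
apply: ae_imp2 z1 z2 => x h1 h2 x01.
have /eqP := h1 x01; rewrite hE mulf_eq0 => /orP[/eqP e|/eqP e].
  by rewrite (_ : B1 x = B0 x) //; lra.
have B1x : B1 x = b1 by rewrite /B1 /bang_bang /chiCplus e ltxx mulr0 addr0.
have := h2 x01 e; move/eqP; rewrite mulf_eq0 => /orP[/eqP BC|/eqP ->]; last by rewrite !mulr0.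
have B00 : B0 x = 0 by move: BC => /(congr1 (@complex.Re R)).
have /andP[l1 _] := admB0.2 x.
by rewrite B1x B00 (_ : b1 = 0) //; apply/eqP; rewrite eq_le b10 andbT -B00.
Qed.
End Perturbation.
End Optimality.

Theorem theorem2p6 (R : realType) (b1 b2 : R) (hb1 : 0 <= b1) (hb12 : b1 < b2)
    (alpha : R) (kappa : R[i]) (hkappa : optimal_qe b1 b2 alpha kappa) :
  exists y : R -> R[i],
    bvp_solution kappa (bang_bang b1 b2 y) y /\
    optimal_structure b1 b2 alpha (bang_bang b1 b2 y).
Proof.
have [beta [Ib kE [B AdB [k0 [y0 bvp]]] kmin]] := optimal_qeP hkappa.
suff [y [bu by_]] : exists y, cbmeas y /\ bvp_solution kappa (bang_bang b1 b2 y) y.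
  exists y; split => //; split; first exact/adm_Ad/bang_bang_adm.
  by exists beta; rewrite -kE; split => //; split => //; exists y.
have i01 : 0 <= (1 : R) <= 1 by apply/andP; split.
have [a0|a0] := eqVneq alpha 0.
  have qe : quasi_eigs B (0 +i* beta) by rewrite -a0 -kE; split => //; exists y0.
  have [b [s [b0 bb sb bs0 rad]]] := zero_frequency hb1 hb12 AdB qe.
  have sol := rsol_ch bs0; rewrite -sqr_imaginary -sb in sol.
  have bn0 : (0 +i* b : R[i]) != 0 by rewrite eq_complex /= negb_and (gt_eqF b0) orbT.
  have ch0 : (ch (b * s) 1)%:C != 0 :> R[i] by rewrite eq_complex /= negb_and gt_eqF // ch_gt0.
  have beq : b = beta.
    apply/eqP; rewrite eq_le bb /=; apply: (kmin (0 +i* b)) => //.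
    exists (fun=> b2).
      by apply: adm_Ad; split; [exact: bmeas_cst|move=> x; rewrite lexx ltW].
    split => //; exists (fun x => (ch (b * s) x)%:C).
    apply: rsol_bvp sol _ rad _ => //; first by exists 1.
    exact: nearW.
  pose d := sqrtc (0 +i* 1 : R[i]).
  have dd : d ^+ 2 = 0 +i* 1 by exact: sqr_sqrtc.
  have d0 : d != 0.
    by apply/eqP => d0; move: dd; rewrite d0 expr0n /= => /(congr1 (@complex.Im R)) /= /eqP; rewrite eq_sym oner_eq0.
  have sold := rsolZ d sol.
  exists (fun x => d * (ch (b * s) x)%:C); split; first by case: sold.
  have kb : kappa = 0 +i* b by rewrite kE a0 beq.
  rewrite kb; apply: rsol_bvp sold _ _ _ => //.
  - by exists 1 => //; rewrite mulf_neq0.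
  - by rewrite /radiating rad; ring.
  - apply: nearW => x _; congr (_%:C * _); rewrite /bang_bang /chiCplus exprMn dd.
    rewrite -rmorphXn ImCM /= mul0r mul1r add0r ?exprn_gt0 ?ch_gt0 //.
    by rewrite mulr1; ring.
have [B0 [p [B0b sol nz rad]]] := bvp_rsol (ltW hb12) k0 AdB bvp.
have aB0 : adm b1 b2 B0 by split => //; case: sol.
have u1 : y0 1 != 0.
  have [x x01 yx] := nz; apply: contra_neq yx => y1.
  by apply: (rsol_backward_unique sol) => //; rewrite rad y1 mulr0 oppr0.
have be0 : beta != 0.
  apply: contra_neq u1 => be0; have kr : kappa = alpha%:C by rewrite kE be0.
  by rewrite kr in sol rad; exact: radiating_real_freq sol rad.
have Imk : Im (kappa ^+ 2) != 0.
  rewrite kE expr2 ImCM /= mulrC -mulr2n mulrn_eq0 /=.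
  by rewrite mulf_eq0 negb_or be0 a0.
pose K := variation_cone b1 b2 B0 y0.
have half w : w != 0 -> ~ K w -> exists y, cbmeas y /\ bvp_solution kappa (bang_bang b1 b2 y) y.
  move=> w0 Kw.
  have [||c c0 hc] := complex_cone_halfplane _ _ w0 Kw.
  - by move=> *; exact: (variation_coneD aB0 sol).
  - by move=> *; exact: variation_coneZ.
  pose d := sqrtc ((0 +i* 1) * c); have dd : d ^+ 2 = (0 +i* 1) * c by exact: sqr_sqrtc.
  have i0 : (0 +i* 1 : R[i]) != 0 by rewrite eq_complex /= oner_eq0 andbF.
  have d0 : d != 0.
    by apply/eqP => d0; move/eqP: dd; rewrite d0 expr0n /= eq_sym mulf_eq0 (negbTE i0) (negbTE c0).
  have sold := rsolZ d sol.
  exists (fun x => d * y0 x); split; first by case: sold.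
  apply: rsol_bvp sold _ _ (halfplane_bang_bang hb1 hb12 aB0 sol c0 Imk hc dd) => //.
  - by exists 1 => //; rewrite mulf_neq0.
  - by rewrite /radiating rad; ring.
have i0 : (0 +i* 1 : R[i]) != 0 by rewrite eq_complex /= oner_eq0 andbF.
have [K1|] := pselect (K 1); last by apply: half; exact: oner_neq0.
have [K2|] := pselect (K (-1)); last by apply: half; rewrite oppr_eq0 oner_neq0.
have [K3|] := pselect (K (0 +i* 1)); last exact: half.
have [K4|] := pselect (K (- (0 +i* 1))); last by apply: half; rewrite oppr_eq0.
have [delta d0 hd] := full_cone_perturbation hb12 k0 aB0 sol rad u1 K1 K2 K3 K4.
pose z : R[i] := alpha +i* (beta - delta).
have zk : N (z - kappa) <= delta.
  rewrite /z kE /N !ReImE /= subrr normr0 add0r addrAC subrr add0r normrN.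
  by rewrite ger0_norm // ltW.
have zn0 : z != 0 by rewrite eq_complex /= negb_and a0.
have := kmin z (hd z zk zn0) erefl; rewrite /z /=; lra.
Qed.
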